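(* Let $m\ge 1$ be an integer and $q\in(0,1)$. The braided ASEP with parameters $m,q$ on a one-dimensional lattice is self-dual (Markov dual to itself) with respect to the function $$ D_b(\eta,\xi)=\prod_{x}\frac{\binom{\eta_x}{\xi_x}_{q^2}}{\binom{m}{\xi_x}_{q^2}}\,q^{\xi_x\left(-2mx+2\overleftarrow{N}_x(\eta)\right)}, $$ where the product is over all lattice sites $x$.
   Context: Notation: $[n]_{q^2}=\frac{1-q^{2n}}{1-q^2}$, $[n]^!_{q^2}=[1]_{q^2}\cdots[n]_{q^2}$ with $[0]^!_{q^2}=1$, $\binom{n}{k}_{q^2}=\frac{[n]^!_{q^2}}{[k]^!_{q^2}[n-k]^!_{q^2}}$ for $0\le k\le n$ and $\binom{n}{k}_{q^2}=0$ if $k>n$; $(a;p)_n=(1-a)(1-ap)\cdots(1-ap^{n-1})$ with $(a;p)_0=1$. Braided ASEP: the lattice is a set of consecutive integers. A configuration $\eta$ assigns to each site $x$ a number $\eta_x=\eta(x)\in\{0,1,\ldots,m\}$ of particles at $x$ (with finitely many particles in total if the lattice is infinite). The process is the continuous-time Markov chain in which, for each pair of neighbouring sites $(x,x+1)$ with $k_1$ particles at $x$ and $k_2$ particles at $x+1$, the pair $(k_1,k_2)$ is replaced by $(l_1,l_2)$, where $l_1+l_2=k_1+k_2$ and $l_1,l_2\in\{0,\ldots,m\}$, at rate $$ \binom{k_1}{l_2}_{q^2}\,(q^{2(m-k_2)};q^{-2})_{k_1-l_2}\,q^{2(m-k_2-k_1+l_2)l_2}, $$ which is understood to be $0$ if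 $l_2>k_1$. The particle number is conserved. $\overleftarrow{N}_x(\eta)=\sum_{y<x}\eta_y$ is the number of particles of $\eta$ strictly to the left of $x$. Duality: two Markov processes $X(t),Y(t)$ on state spaces $\mathfrak{X},\mathfrak{Y}$ are Markov dual with respect to a function $D$ on $\mathfrak{X}\times\mathfrak{Y}$ if $\mathbb{E}_x[D(X(t),y)]=\mathbb{E}_y[D(x,Y(t))]$ for all $t\ge 0$, $x\in\mathfrak{X}$, $y\in\mathfrak{Y}$. For discrete state spaces this is expressed through the generators, viewed as matrices whose $(x,x')$ entry for $x\neq x'$ is the jump rate from $x$ to $x'$, as $L_XD=DL_Y^T$. *)

(* Defs.v *)
From HB Require Import structures.
From mathcomp Require Import all_boot all_order all_algebra.
From mathcomp Require Import finmap.
From mathcomp Require Import all_classical all_reals all_analysis.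

Set Implicit Arguments.
Unset Strict Implicit.
Unset Printing Implicit Defensive.

Import Order.TTheory GRing.Theory Num.Theory.
Import numFieldNormedType.Exports.

Local Open Scope classical_set_scope.
Local Open Scope ring_scope.

Section MarkovDuality.
Variable R : realType.

(* \esum only handles nonnegative families, so signed families are summed as
   (sum of positive parts) - (sum of negative parts). *)
Definition ssum (T : choiceType) (f : T -> R) : \bar R :=
  ((\esum_(x in [set: T]) (Num.max (f x) 0)%:E) -
   (\esum_(x in [set: T]) (Num.max (- f x) 0)%:E))%E.

(* The Q-matrix of a family of jump rates; the diagonal of [r] is ignored. *)
Definition generator (T : choiceType) (r : T -> T -> R) (x y : T) : R :=
  if x == y then - fine (\esum_(z in [set z | z != x]) (r x z)%:E)%E
  else r x y.

(* [P t x y] is the probability that the chain started from [x] is in [y] at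
   time [t]. Only the values at t >= 0 are constrained. The last field says
   that P_h(x, y) = 1_{x = y} + h L(x, y) + o(h) as h tends to 0 from above. *)
Record is_markov_chain (T : choiceType) (r : T -> T -> R)
    (P : R -> T -> T -> R) : Prop := IsMarkovChain {
  transition_ge0 : forall t x y, 0 <= t -> 0 <= P t x y;
  transition_sum1 : forall t x, 0 <= t ->
    (\esum_(y in [set: T]) (P t x y)%:E = 1)%E;
  transition_at0 : forall x y, P 0 x y = (x == y)%:R;
  transition_semigroup : forall s t x y, 0 <= s -> 0 <= t ->
    ((P (s + t) x y)%:E = \esum_(z in [set: T]) (P s x z * P t z y)%:E)%E;
  transition_rates : forall x y,
    (P h x y - (x == y)%:R) / h @[h --> 0^'+] --> generator r x y
}.

(* E_x[f(X(t))] *)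
Definition expect (T : choiceType) (P : R -> T -> T -> R) (t : R) (x : T)
  (f : T -> R) : \bar R := ssum (fun x' => P t x x' * f x').

Definition markov_dual (T U : choiceType) (P : R -> T -> T -> R)
    (P' : R -> U -> U -> R) (D : T -> U -> R) : Prop :=
  forall t x y, 0 <= t ->
    expect P t x (fun x' => D x' y) = expect P' t y (fun y' => D x y').

(* L D = D L'^T as matrices *)
Definition generator_dual (T U : choiceType) (L : T -> T -> R)
    (L' : U -> U -> R) (D : T -> U -> R) : Prop :=
  forall x y,
    ssum (fun x' => L x x' * D x' y) = ssum (fun y' => D x y' * L' y y').

End MarkovDuality.

Section QCalculus.
Variable R : realType.
Implicit Types a p : R.

Definition qnum p (n : nat) : R := (1 - p ^+ n) / (1 - p).

Definition qfact p (n : nat) : R := \prod_(i < n) qnum p i.+1.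

Definition qbinom p (n k : nat) : R :=
  if (k <= n)%N then qfact p n / (qfact p k * qfact p (n - k)) else 0.

Definition qpoch a p (n : nat) : R := \prod_(i < n) (1 - a * p ^+ i).

End QCalculus.

Section BraidedASEP.
Variables (R : realType) (m : nat) (q : R).

(* The lattice is [La]; configurations are extended by 0 outside [La]. *)
Definition config (La : set int) : Type :=
  {eta : {fsfun int -> 'I_m.+1 with ord0} |
     `[< forall x, ~ La x -> eta x = ord0 >]}.

HB.instance Definition _ (La : set int) := Choice.on (config La).

Definition occ (La : set int) (eta : config La) (x : int) : nat :=
  val (val eta x).

(* Rate of (k1, k2) -> (k1 + k2 - l2, l2). *)
Definition pair_rate (k1 k2 l2 : nat) : R :=
  if (l2 <= k1)%N then
    qbinom (q ^+ 2) k1 l2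
    * qpoch (q ^ (2 * (m%:Z - k2%:Z))) (q ^- 2) (k1 - l2)
    * q ^ (2 * (m%:Z - k2%:Z - k1%:Z + l2%:Z) * l2%:Z)
  else 0.

(* Bonds (x, x+1) of the lattice whose update can turn [eta] into [xi]. *)
Definition bonds (La : set int) (eta xi : config La) : set int :=
  [set x | [/\ La x, La (x + 1),
    (occ xi x + occ xi (x + 1) = occ eta x + occ eta (x + 1))%N &
    forall y, y != x -> y != x + 1 -> occ xi y = occ eta y]].

(* For eta != xi the set [bonds eta xi] has at most one element. *)
Definition asep_rate (La : set int) (eta xi : config La) : R :=
  \sum_(x \in bonds eta xi)
    pair_rate (occ eta x) (occ eta (x + 1)) (occ xi (x + 1)).

Definition left_count (La : set int) (eta : config La) (x : int) : nat :=
  (\big[addn/0]_(y \in [set y | La y /\ (y < x)%R]) occ eta y)%N.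

Definition duality_fun (La : set int) (eta xi : config La) : R :=
  \big[*%R/1]_(x \in La)
    (qbinom (q ^+ 2) (occ eta x) (occ xi x) / qbinom (q ^+ 2) m (occ xi x)
     * q ^ ((occ xi x)%:Z * (- (2 * m%:Z * x) + 2 * (left_count eta x)%:Z))).

End BraidedASEP.

Arguments duality_fun {R} m q La eta xi.
Arguments asep_rate {R} m q La eta xi.

(* Main.v *)
Require Import Defs.
From mathcomp Require Import all_boot all_order all_algebra.
From mathcomp Require Import finmap.
From mathcomp Require Import all_classical all_reals all_analysis.
From mathcomp Require Import ring lra zify.

Set Implicit Arguments.
Unset Strict Implicit.
Unset Printing Implicit Defensive.

Import Order.TTheory GRing.Theory Num.Theory.
Import numFieldNormedType.Exports.

Local Open Scope classical_set_scope.
Local Open Scope ring_scope.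

(** The proof has an algebraic half, the generator identity L D = D L^T, and an
    analytic half, which passes from generators to arbitrary semigroups with
    the given rates.

    Put p = q^2. A configuration has finitely many particles, only finitely
    many bonds can change it, and D splits, up to a factor which an update of
    the bond (x, x+1) leaves unchanged, as a function [pair_dual] of the two
    sites ([duality_fun_bond]). Counting the updates that change nothing, every
    bond is updated at total rate 1 ([swap_law_sum1]), so the generator identity
    reduces to an identity for the rates of one bond, [swap_duality].

    To see that identity, let A = k1, let H = m - k2 be the number of holes at
    x+1, and let t = k1 - l2 be the number of particles that stay at x. The rate
    is then [rank_law] A H t which, when 1/p is the order of a finite field, is
    the probability that a random A x H matrix over this field has rank t.
    Drawing the rows one at a time, the corank H - t evolves by A steps of the
    Markov chain which, from the state H, stays with probability p^H and moves
    to H - 1 otherwise ([sum_rank_law]). Standard identities for Gaussian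
    binomials turn both sides of [swap_duality] into the same factor times the
    expectation of g(x, y) = binom(m - x, y) / binom(m, y) after k1 - j2 steps
    of this chain, run in x on one side and in y on the other ([sum_swap_dual],
    [sum_swap_dual_transpose]). One step in x has the same effect on g as one
    step in y ([corank_step_dual]), and steps in x commute with steps in y, so
    the same holds for any number of steps ([iter_intertwine]).

    For the analytic half, only the behaviour of P_h at h = 0 is given. Each
    configuration lies in the closed class of configurations with the same
    number of particles, on which the exit rates are at most some c. The
    semigroup law alone yields, on such a class and uniformly in the states,
    P_h >= exp(-ch) (1 + h (L + c)) entrywise ([stay_ge], [jump_ge]).
    Iterating n times with h = t/n bounds E_x[f(X(t))] from below by
    exp(-ct) (1 + h (L + c))^n f for every f >= 0. Applied to f and to B - f,
    where 0 <= f <= B, this pins the expectation down up to an error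
    B (ct)^2 / n ([expect_euler_approx]). The approximations only involve finite
    sums, and by the generator identity the steps in the two variables agree on
    D and commute, so [iter_intertwine] applies again: the two sides of the
    duality have the same approximations, hence are equal
    ([markov_dual_of_drift]). This requires D to be nonnegative and bounded in
    each variable. *)

(** * Finite sums and commuting operators *)

Lemma iter_commute (R : pzRingType) (X Y : Type)
    (U : (X -> R) -> X -> R) (V : (Y -> R) -> Y -> R) :
  (forall (G : X -> Y -> R) x y,
     U (fun x' => V (G x') y) x = V (fun y' => U (G^~ y') x) y) ->
  forall n (G : X -> Y -> R) x y,
    U (fun x' => iter n V (G x') y) x = iter n V (fun y' => U (G^~ y') x) y.
Proof.
move=> UV; elim=> [//|n IH] G x y /=.
rewrite (UV (fun x' => iter n V (G x'))); congr (V _ y).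
by apply/funext => y'; rewrite IH.
Qed.

(** By induction, U^(n+1) D = U V^n D = V^n U D = V^(n+1) D, because operators
    acting on different variables commute. The locality hypotheses allow U D
    and V D to agree on a part of the product only. *)
Lemma iter_intertwine (R : pzRingType) (X Y : Type) (PX : set X) (PY : set Y)
    (U : (X -> R) -> X -> R) (V : (Y -> R) -> Y -> R) (D : X -> Y -> R) :
  (forall f g, {in PX, f =1 g} -> {in PX, U f =1 U g}) ->
  (forall f g, {in PY, f =1 g} -> {in PY, V f =1 V g}) ->
  (forall (G : X -> Y -> R) x y,
     U (fun x' => V (G x') y) x = V (fun y' => U (G^~ y') x) y) ->
  (forall x y, PX x -> PY y -> U (D^~ y) x = V (D x) y) ->
  forall n x y, PX x -> PY y -> iter n U (D^~ y) x = iter n V (D x) y.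
Proof.
move=> Uloc Vloc UV UVD n; elim: n => [//|n IH] x y Px Py.
have Vnloc f g : {in PY, f =1 g} -> {in PY, iter n V f =1 iter n V g}.
  by move=> fg; elim: n {IH} => [//|k IHk] /=; exact: Vloc.
rewrite iterS (Uloc _ (fun x' => iter n V (D x') y)) ?inE //; last first.
  by move=> x'; rewrite inE => Px'; exact: IH.
rewrite iter_commute // iterSr; apply: Vnloc; rewrite ?inE // => y'.
by rewrite inE => Py'; exact: UVD.
Qed.

Lemma sum_ord_tail (R : pzRingType) (F : nat -> R) n N : (n <= N)%N ->
  (forall t, (n <= t)%N -> F t = 0) -> \sum_(t < N) F t = \sum_(t < n) F t.
Proof.
move=> nN F0; rewrite -!(big_mkord xpredT F) (big_cat_nat (leq0n n) nN) /=.
by rewrite big_nat [X in _ + X]big_nat [X in _ + X]big1 ?addr0 -?big_nat //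
  => t /andP[/F0].
Qed.

Lemma fsbigD1_supp (V : Type) (idx : V) (op : Monoid.com_law idx)
    (I : choiceType) (x : I) (A : set I) (F : I -> V) :
  A x -> finite_set (A `&` F @^-1` [set~ idx]) ->
  \big[op/idx]_(i \in A) F i = op (F x) (\big[op/idx]_(i \in A `\ x) F i).
Proof.
move=> Ax fin; pose B := A `&` (x |` (A `&` F @^-1` [set~ idx])).
have finB : finite_set B.
  by apply: finite_setIr; rewrite finite_setU; split => //; exact: finite_set1.
have out i : A i -> ~ B i -> F i = idx.
  move=> Ai nBi; apply: contrapT => Fi; apply: nBi; split => //; right.
  by split.
rewrite -(fsbig_widen B A) //; first last.
- by move=> i [Ai nBi]; exact: out.
- by move=> i [].
rewrite (fsbigD1 x) //; last by split => //; left.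
congr (op _ _); apply: fsbig_widen => [i [[Ai _] ix]|i [[Ai ix] nBi]] //.
by apply: out => // Bi; apply: nBi; split.
Qed.

Lemma fsbig_seq_supp (V : Type) (idx : V) (op : Monoid.com_law idx)
    (I : choiceType) (s : seq I) (A : set I) (F : I -> V) :
  uniq s -> (forall i, i \in s -> A i) ->
  (forall i, A i -> i \notin s -> F i = idx) ->
  \big[op/idx]_(i \in A) F i = \big[op/idx]_(i <- s) F i.
Proof.
move=> us sA F0; rewrite (fsbigE s) //.
rewrite big_seq_cond [RHS]big_seq_cond; apply: eq_bigl => i.
by case: (boolP (i \in s)) => // /sA ?; rewrite mem_set.
Qed.

(** * Gaussian binomials and the duality of the braiding *)

Section QBinomial.
Variables (R : realType) (p : R).
Hypotheses (p_gt0 : 0 < p) (p_lt1 : p < 1).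

Lemma qnum_gt0 n : 0 < qnum p n.+1.
Proof.
by apply: divr_gt0; rewrite subr_gt0 // exprn_ilt1 // ltW.
Qed.

Lemma qfactS n : qfact p n.+1 = qfact p n * qnum p n.+1.
Proof. by rewrite /qfact big_ord_recr. Qed.

Lemma qfact_gt0 n : 0 < qfact p n.
Proof. by apply: prodr_gt0 => i _; exact: qnum_gt0. Qed.

Lemma qfact_neq0 n : qfact p n != 0.
Proof. by rewrite gt_eqF ?qfact_gt0. Qed.

Lemma qbinom_small n k : (n < k)%N -> qbinom p n k = 0.
Proof. by rewrite /qbinom ltnNge => /negbTE ->. Qed.

Lemma qbinom_gt0 n k : (k <= n)%N -> 0 < qbinom p n k.
Proof.
by move=> kn; rewrite /qbinom kn; apply: divr_gt0; rewrite ?mulr_gt0 ?qfact_gt0.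
Qed.

Lemma qbinom_ge0 n k : 0 <= qbinom p n k.
Proof.
by case: (leqP k n) => kn; [exact/ltW/qbinom_gt0|rewrite qbinom_small].
Qed.

Lemma qbinom_sub n k : (k <= n)%N -> qbinom p n (n - k) = qbinom p n k.
Proof.
by move=> kn; rewrite /qbinom kn leq_subr subKn // [X in _ / X]mulrC.
Qed.

Lemma qbinom0 n : qbinom p n 0 = 1.
Proof.
by rewrite /qbinom subn0 /= {2}/qfact big_ord0 mul1r divff ?qfact_neq0.
Qed.

Lemma qbinomnn n : qbinom p n n = 1.
Proof. by rewrite -qbinom_sub // subnn qbinom0. Qed.

Lemma qbinomS n k :
  qbinom p n.+1 k.+1 = qbinom p n k + p ^+ k.+1 * qbinom p n k.+1.
Proof.
case: (ltngtP k n) => [kn|nk|->].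
- rewrite /qbinom !ltnS (ltnW kn) kn subSS.
  have [d nE] : exists d, n = (k + d.+1)%N by exists (n - k.+1)%N; lia.
  have -> : (n - k = d.+1)%N by lia.
  have -> : (n - k.+1 = d)%N by lia.
  have e : qnum p n.+1 = qnum p k.+1 + p ^+ k.+1 * qnum p d.+1.
    have p1 : 1 - p != 0 by rewrite gt_eqF // subr_gt0.
    by rewrite nE -addSn /qnum exprD; field.
  rewrite !qfactS e.
  field.
  by rewrite !qfact_neq0 ?(gt_eqF (qnum_gt0 _)).
- by rewrite !qbinom_small ?mulr0 ?addr0 //; lia.
- by rewrite !qbinomnn qbinom_small // mulr0 addr0.
Qed.

(** The analogue of counting in two ways the pairs of nested subsets of sizes
    [j] and [j + t]. *)
Lemma qbinom_mul_qbinom n j t :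
  qbinom p n (j + t) * qbinom p (j + t) j = qbinom p n j * qbinom p (n - j) t.
Proof.
case: (leqP (j + t) n) => h; last first.
  rewrite qbinom_small // mul0r.
  case: (leqP j n) => jn; last by rewrite qbinom_small ?mul0r.
  by rewrite [X in _ * X]qbinom_small ?mulr0 //; lia.
rewrite /qbinom h leq_addr.
have -> : (j <= n)%N by lia.
have -> : (t <= n - j)%N by lia.
have -> : (j + t - j = t)%N by lia.
have -> : (n - j - t = n - (j + t))%N by lia.
by field; rewrite !qfact_neq0.
Qed.

(** For [p] the inverse of the order of a field, the probability that [t]
    random vectors of dimension [n] are linearly independent. *)
Definition qfall (n t : nat) : R := \prod_(i < t) (1 - p ^+ (n - i)).

Lemma qfallS n t : qfall n t.+1 = (1 - p ^+ n) * qfall n.-1 t.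
Proof.
rewrite /qfall big_ord_recl subn0; congr (_ * _).
by apply: eq_bigr => i _; rewrite /= /bump /=; congr (1 - _ ^+ _); lia.
Qed.

Lemma qfall_small n t : (n < t)%N -> qfall n t = 0.
Proof.
move=> nt; rewrite /qfall (bigD1 (Ordinal nt)) //=.
by rewrite subnn expr0 subrr mul0r.
Qed.

Lemma qfall_ge0 n t : 0 <= qfall n t.
Proof.
by apply: prodr_ge0 => i _; rewrite subr_ge0 exprn_ile1 // ltW.
Qed.

Lemma qfallE n t : qfall n t = qbinom p n t * qfall t t.
Proof.
case: (leqP t n) => tn; last by rewrite qfall_small // qbinom_small // mul0r.
have p1 : 1 - p != 0 by rewrite gt_eqF // subr_gt0.
have key k s : qfall (k + s) s * qfact p k = (1 - p) ^+ s * qfact p (k + s).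
  elim: s => [|s IH]; first by rewrite addn0 /qfall big_ord0.
  rewrite qfallS addnS /= -mulrA IH qfactS /qnum [(1 - p) ^+ _.+1]exprS; field.
  exact: p1.
have := key (n - t)%N t; rewrite subnK // => e.
have := key 0%N t; rewrite add0n /qfact big_ord0 mulr1 -/(qfact p t) => ->.
rewrite /qbinom tn -[LHS](mulfK (qfact_neq0 (n - t))) e; field.
by rewrite !qfact_neq0.
Qed.

(** For [p] the inverse of the order of a field, the probability that a random
    [A] x [H] matrix over it has rank [t]. *)
Definition rank_law (A H t : nat) : R :=
  qbinom p A t * qfall H t * p ^+ ((H - t) * (A - t)).

Lemma rank_law_ge0 A H t : 0 <= rank_law A H t.
Proof.
by rewrite !mulr_ge0 ?qbinom_ge0 ?qfall_ge0 ?exprn_ge0 // ltW.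
Qed.

(** The dimension [H] of the space of vectors orthogonal to the rows drawn so
    far drops by one unless the next random row is orthogonal to the whole
    space, which happens with probability [p ^+ H]. *)
Definition corank_step (f : nat -> R) (H : nat) : R :=
  p ^+ H * f H + (1 - p ^+ H) * f H.-1.

Lemma rank_law0 A H : rank_law A H 0 = p ^+ (H * A).
Proof. by rewrite /rank_law qbinom0 /qfall big_ord0 !mul1r !subn0. Qed.

Lemma rank_law_small A H t : (A < t)%N -> rank_law A H t = 0.
Proof. by move=> At; rewrite /rank_law qbinom_small // !mul0r. Qed.

(** Conditioning on whether the first row of the matrix vanishes; after
    factoring out the common terms this is the [q]-Pascal rule. *)
Lemma rank_lawS A H t : rank_law A.+1 H t.+1 =
  p ^+ H * rank_law A H t.+1 + (1 - p ^+ H) * rank_law A H.-1 t.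
Proof.
case: (ltnP t H) => tH; last first.
  rewrite /rank_law (@qfall_small H t.+1) // !(mulr0, mul0r, add0r).
  case: H tH => [_|H tH]; first by rewrite expr0 subrr mul0r.
  by rewrite qfall_small // !(mulr0, mul0r).
case: H tH => // H; rewrite ltnS => tH.
rewrite /rank_law qbinomS qfallS /= !subSS.
case: (leqP t.+1 A) => tA; last first.
  by rewrite (@qbinom_small A t.+1) //; ring.
have -> : p ^+ ((H - t) * (A - t)) =
    p ^+ ((H - t) * (A - t.+1)) * p ^+ (H - t).
  by rewrite -exprD -mulnSr; congr (_ ^+ (_ * _)%N); lia.
have -> : p ^+ H.+1 = p ^+ t.+1 * p ^+ (H - t).
  by rewrite -exprD; congr (_ ^+ _); lia.
ring.
Qed.

Lemma sum_rank_law A f H :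
  \sum_(t < A.+1) rank_law A H t * f (H - t)%N = iter A corank_step f H.
Proof.
elim: A H => [|A IH] H.
  by rewrite big_ord1 rank_law0 muln0 expr0 mul1r subn0.
rewrite iterS {1}/corank_step -!IH big_ord_recl subn0 rank_law0.
under eq_bigr => t _ do rewrite lift0 rank_lawS mulrDl.
rewrite big_split /= addrA; congr (_ + _).
- rewrite big_ord_recr [in RHS]big_ord_recl /= rank_law_small //.
  rewrite mulr0 mul0r addr0 mulrDr rank_law0 subn0 mulrA -exprD.
  congr (_ ^+ _ * _ + _); first by lia.
  rewrite mulr_sumr; by apply: eq_bigr => i _; rewrite mulrA.
- rewrite mulr_sumr; apply: eq_bigr => t _; rewrite -!mulrA.
  case: H => [|H]; first by rewrite expr0 subrr !mul0r.
  by rewrite /= subSS.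
Qed.

Lemma qbinom_absorb n k :
  qbinom p n k.+1 * (1 - p ^+ k.+1) = qbinom p n k * (1 - p ^+ (n - k)).
Proof.
case: (ltngtP k n) => [kn|nk|->].
- have p1 : 1 - p != 0 by rewrite gt_eqF // subr_gt0.
  have k1 : 1 - p ^+ k.+1 != 0 by rewrite gt_eqF // subr_gt0 exprn_ilt1 // ltW.
  have d1 : 1 - p ^+ (n - k.+1).+1 != 0.
    by rewrite gt_eqF // subr_gt0 exprn_ilt1 // ltW.
  rewrite /qbinom kn ltnW // (_ : n - k = (n - k.+1).+1)%N; last by lia.
  rewrite !qfactS /qnum; field.
  by rewrite !qfact_neq0 p1 k1 d1.
- by rewrite !qbinom_small ?mul0r // ltnS ltnW.
- by rewrite qbinom_small // subnn expr0 subrr mul0r mulr0.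
Qed.

(** Two ways of forming the multinomial coefficient of [j] and [t] in [n]. *)
Lemma qbinom_exchange n j t :
  qbinom p n t * qbinom p (n - t) j = qbinom p n j * qbinom p (n - j) t.
Proof.
rewrite -!qbinom_mul_qbinom addnC; congr (_ * _).
by rewrite -(@qbinom_sub (j + t) j) ?leq_addr // addKn.
Qed.

Variable m : nat.

(** Symmetric in [x] and [y]: for [x + y <= m] it is the quotient of
    [qfact p (m - x) * qfact p (m - y)] by
    [qfact p m * qfact p (m - x - y)]. *)
Definition corank_dual (x y : nat) : R := qbinom p (m - x) y / qbinom p m y.

(** For [H + J <= m] both sides are [corank_dual H J] times the quotient of
    1 - p^(m+1-H) - p^(m+1-J) + p^(m+1) by 1 - p^(m+1-H-J), which is symmetric
    in [H] and [J]. The proof avoids this quotient, whose denominator vanishes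
    for [H + J = m + 1], and uses the Pascal and absorption rules instead. *)
Lemma corank_step_dual H J : (H <= m)%N -> (J <= m)%N ->
  corank_step (corank_dual^~ J) H = corank_step (corank_dual H) J.
Proof.
have nz k : (k <= m)%N -> qbinom p m k != 0.
  by move=> km; rewrite gt_eqF // qbinom_gt0.
rewrite /corank_step /corank_dual; case: H => [|H] Hm; case: J => [|J] Jm //=.
- by rewrite subn0 (divff (nz _ Jm)) (divff (nz _ (ltnW Jm))) expr0; ring.
- by rewrite !qbinom0 !divr1 expr0; ring.
have e1 := qbinom_absorb m J.
have -> : (m - H = (m - H.+1).+1)%N by lia.
set n := (m - H.+1)%N; rewrite qbinomS.
have e2 := qbinom_absorb n J.
have e3 : qbinom p n J * p ^+ (m - J) =
    qbinom p n J * (p ^+ H.+1 * p ^+ (n - J)).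
  case: (leqP J n) => Jn; last by rewrite qbinom_small // !mul0r.
  by rewrite -exprD; congr (_ * _ ^+ _); rewrite /n; lia.
have nzJ1 := nz _ Jm; have nzJ := nz _ (ltnW Jm).
apply: (mulIf nzJ1); apply: (mulIf nzJ).
transitivity (qbinom p m J * (p ^+ H.+1 * qbinom p n J.+1 +
  (1 - p ^+ H.+1) * (qbinom p n J + p ^+ J.+1 * qbinom p n J.+1))).
  by field; rewrite nzJ1.
transitivity (qbinom p m J * p ^+ J.+1 * qbinom p n J.+1 +
  qbinom p m J.+1 * (1 - p ^+ J.+1) * qbinom p n J); last first.
  by field; rewrite nzJ nzJ1.
rewrite e1 -mulrA -[X in _ = _ + X]mulrA -mulrDr; congr (_ * _).
transitivity (p ^+ J.+1 * qbinom p n J.+1 + qbinom p n J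
   - qbinom p n J * p ^+ (m - J)); last by ring.
rewrite e3.
transitivity (p ^+ J.+1 * qbinom p n J.+1 + qbinom p n J
   + p ^+ H.+1 * (qbinom p n J.+1 * (1 - p ^+ J.+1)) - p ^+ H.+1 * qbinom p n J).
  by ring.
by rewrite e2; ring.
Qed.

Lemma iter_corank_dual A H J : (H <= m)%N -> (J <= m)%N ->
  iter A corank_step (corank_dual^~ J) H = iter A corank_step (corank_dual H) J.
Proof.
apply: (@iter_intertwine R nat nat (fun x => (x <= m)%N) (fun x => (x <= m)%N)).
- move=> f f' ff' x; rewrite inE => xm; rewrite /corank_step !ff' ?inE //; lia.
- move=> f f' ff' x; rewrite inE => xm; rewrite /corank_step !ff' ?inE //; lia.
- by move=> G x y; rewrite /corank_step; ring.
- exact: corank_step_dual.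
Qed.

(** [k1 - l] of the [k1] particles of the left site stay, the other [l] move
    right, and all [k2] particles of the right site move left. *)
Definition swap_law (k1 k2 l : nat) : R :=
  if (l <= k1)%N then rank_law k1 (m - k2) (k1 - l) else 0.

Lemma sum_swap_law k1 k2 (F : nat -> R) : (k1 <= m)%N ->
  \sum_(l < m.+1) swap_law k1 k2 l * F l =
  \sum_(t < k1.+1) rank_law k1 (m - k2) t * F (k1 - t)%N.
Proof.
move=> k1m; rewrite (@sum_ord_tail _ (fun l => swap_law k1 k2 l * F l) k1.+1) //.
  rewrite (reindex_inj rev_ord_inj) /=; apply: eq_bigr => t _.
  have tk := ltn_ord t; rewrite /swap_law subSS leq_subr.
  by congr (rank_law _ _ _ * _); lia.
by move=> t tk; rewrite /swap_law leqNgt tk mul0r.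
Qed.

(** The part of the duality function that depends on how the particles of both
    configurations are distributed over one bond. *)
Definition pair_dual (k1 k2 j1 j2 : nat) : R :=
  qbinom p k1 j1 / qbinom p m j1 * (qbinom p k2 j2 / qbinom p m j2)
  / p ^+ (j2 * (m - k1)).

(** Absorbing [binom(l, j2)] into the weight of [l] replaces [k1] by [k1 - j2]
    in the rank law and leaves a function of the corank [m - k2 - t]. *)
Lemma sum_swap_dual k1 k2 j1 j2 : (k1 <= m)%N -> (k2 <= m)%N ->
  \sum_(l < m.+1) swap_law k1 k2 l * pair_dual (k1 + k2 - l) l j1 j2 =
  qbinom p k1 j2 / qbinom p m j2 *
    iter (k1 - j2) corank_step (corank_dual^~ j1) (m - k2)%N.
Proof.
move=> k1m k2m.
rewrite (sum_swap_law k2 (fun l => pair_dual (k1 + k2 - l) l j1 j2)) //.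
rewrite -sum_rank_law mulr_sumr.
rewrite -(@sum_ord_tail _ (fun t => qbinom p k1 j2 / qbinom p m j2 *
   (rank_law (k1 - j2) (m - k2) t * corank_dual (m - k2 - t) j1)) _ k1.+1).
- apply: eq_bigr => -[t /= tk] _; rewrite ltnS in tk.
  rewrite /pair_dual /corank_dual /rank_law.
  have -> : (k1 + k2 - (k1 - t) = k2 + t)%N by lia.
  case: (leqP t (m - k2)) => tH; last by rewrite qfall_small // !(mulr0, mul0r).
  have -> : (m - (m - k2 - t) = k2 + t)%N by lia.
  have -> : (m - (k2 + t) = m - k2 - t)%N by lia.
  have e := qbinom_exchange k1 j2 t.
  have pn n : p ^+ n != 0 by rewrite expf_neq0 // gt_eqF.
  case: (leqP (j2 + t) k1) => jt; last first.
    rewrite (@qbinom_small (k1 - t) j2); last by lia.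
    case: (leqP j2 k1) => jk.
      rewrite (@qbinom_small (k1 - j2) t); last by lia.
      by rewrite !(mulr0, mul0r).
    by rewrite (@qbinom_small k1 j2) // !(mulr0, mul0r).
  have -> : p ^+ ((m - k2 - t) * (k1 - t)) =
     p ^+ ((m - k2 - t) * (k1 - j2 - t)) * p ^+ (j2 * (m - k2 - t)).
    rewrite -exprD [(j2 * _)%N]mulnC -mulnDr; congr (_ ^+ (_ * _)%N); lia.
  transitivity (qbinom p k1 t * qbinom p (k1 - t) j2 * (qfall (m - k2) t *
    p ^+ ((m - k2 - t) * (k1 - j2 - t)) *
    (qbinom p (k2 + t) j1 / qbinom p m j1 / qbinom p m j2))).
    move: (pn (j2 * (m - k2 - t))%N); set u := p ^+ (j2 * _) => u0.
    rewrite -[RHS]mulr1 -(divff u0); ring.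
  rewrite e; ring.
- by rewrite ltnS leq_subr.
- by move=> t tk; rewrite rank_law_small // !(mul0r, mulr0).
Qed.

(** The rank law is symmetric in the two sizes of the matrix (transposition), so
    the weights here, whose second size is [m - j2], can be traded for those of
    the chain with [k1 - j2] steps started from [j1]. *)
Lemma sum_swap_dual_transpose k1 k2 j1 j2 :
  (k1 <= m)%N -> (k2 <= m)%N -> (j1 <= m)%N -> (j2 <= m)%N ->
  \sum_(i < m.+1) swap_law j1 j2 i * pair_dual k1 k2 (j1 + j2 - i) i =
  qbinom p k1 j2 / qbinom p m j2 *
    iter (k1 - j2) corank_step (corank_dual (m - k2)) j1.
Proof.
move=> k1m k2m j1m j2m.
rewrite (sum_swap_law j2 (fun i => pair_dual k1 k2 (j1 + j2 - i) i)) //.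
rewrite -sum_rank_law mulr_sumr.
pose G t := qbinom p k1 j2 / qbinom p m j2 *
   (rank_law (k1 - j2) j1 t * corank_dual (m - k2) (j1 - t)).
rewrite -(@sum_ord_tail _ G _ (k1 - j2 + j1).+1); first last.
- by move=> t tk; rewrite /G rank_law_small // !(mul0r, mulr0).
- by rewrite ltnS leq_addr.
rewrite (@sum_ord_tail _ G j1.+1); first last.
- move=> t tk; rewrite /G /rank_law qfall_small // !(mul0r, mulr0).
  by [].
- by rewrite ltnS leq_addl.
apply: eq_bigr => -[t /= tk] _; rewrite ltnS in tk.
rewrite /G /pair_dual /corank_dual /rank_law.
have -> : (j1 + j2 - (j1 - t) = j2 + t)%N by lia.
have -> : (m - (m - k2) = k2)%N by lia.
case: (leqP (j2 + t) k1) => jt; last first.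
  rewrite (@qbinom_small k1 (j2 + t)) //.
  case: (leqP j2 k1) => jk.
    rewrite (@qbinom_small (k1 - j2) t); last by lia.
    by rewrite !(mulr0, mul0r).
  by rewrite (@qbinom_small k1 j2) // !(mulr0, mul0r).
rewrite (qfallE (m - j2)) (qfallE j1).
have e1 := qbinom_mul_qbinom k1 j2 t.
have e2 := qbinom_mul_qbinom m j2 t.
have -> : p ^+ ((m - j2 - t) * (j1 - t)) =
   p ^+ ((j1 - t) * (k1 - j2 - t)) * p ^+ ((j1 - t) * (m - k1)).
  rewrite -exprD -mulnDr mulnC; congr (_ ^+ (_ * _)%N); lia.
have : p ^+ ((j1 - t) * (m - k1)) != 0 by rewrite expf_neq0 // gt_eqF.
set u := p ^+ ((j1 - t) * (m - k1)) => u0.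
have nz n k : (k <= n)%N -> qbinom p n k != 0.
  by move=> kn; rewrite gt_eqF // qbinom_gt0.
have z1 : qbinom p m j2 != 0 by rewrite nz.
have z2 : qbinom p m (j2 + t) != 0 by rewrite nz //; lia.
have z3 : qbinom p m (j1 - t) != 0 by rewrite nz //; lia.
have z4 : qbinom p (j2 + t) j2 != 0 by rewrite nz //; lia.
have -> : qbinom p (m - j2) t =
    qbinom p m (j2 + t) * qbinom p (j2 + t) j2 / qbinom p m j2.
  by rewrite e2 mulrC mulKf.
transitivity (qbinom p k1 (j2 + t) * qbinom p (j2 + t) j2 *
  (qbinom p j1 t * qfall t t * p ^+ ((j1 - t) * (k1 - j2 - t)) *
   (qbinom p k2 (j1 - t) / qbinom p m (j1 - t)) / qbinom p m j2)).
  by field; rewrite u0 z1 z2 z3.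
by rewrite e1; field; rewrite z1 z3.
Qed.

Lemma swap_duality k1 k2 j1 j2 :
  (k1 <= m)%N -> (k2 <= m)%N -> (j1 <= m)%N -> (j2 <= m)%N ->
  \sum_(l < m.+1) swap_law k1 k2 l * pair_dual (k1 + k2 - l) l j1 j2 =
  \sum_(i < m.+1) swap_law j1 j2 i * pair_dual k1 k2 (j1 + j2 - i) i.
Proof.
move=> k1m k2m j1m j2m.
by rewrite sum_swap_dual // sum_swap_dual_transpose // iter_corank_dual //;
  exact: leq_subr.
Qed.

(** The case without dual particles of the duality. *)
Lemma swap_law_sum1 k1 k2 : (k1 <= m)%N -> (k2 <= m)%N ->
  \sum_(l < m.+1) swap_law k1 k2 l = 1.
Proof.
move=> k1m k2m; have := swap_duality k1m k2m (leq0n m) (leq0n m).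
have d0 a b : pair_dual a b 0 0 = 1.
  by rewrite /pair_dual !qbinom0 mul0n expr0 !divr1 mulr1.
under eq_bigr => l _ do rewrite d0 mulr1.
move=> ->; rewrite big_ord_recl big1 ?addr0.
  rewrite /swap_law /= d0 mulr1.
  by rewrite rank_law0 muln0 expr0.
by move=> i _; rewrite /swap_law /= mul0r.
Qed.

Lemma swap_law_ge0 k1 k2 l : 0 <= swap_law k1 k2 l.
Proof. by rewrite /swap_law; case: ifP => // _; exact: rank_law_ge0. Qed.

End QBinomial.

(** * Generators with finite rows *)

Section FiniteRows.
Variables (R : realType) (T : choiceType).
Implicit Types (r : T -> T -> R) (f g : T -> R).

Lemma esum_seq f (s : seq T) : uniq s -> (forall x, 0 <= f x) ->
  (forall x, x \notin s -> f x = 0) ->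
  (\esum_(x in [set: T]) (f x)%:E = (\sum_(x <- s) f x)%:E)%E.
Proof.
move=> us f0 fs; rewrite -sumEFin fsbig_seq // -esum_fset.
- rewrite [RHS]esum_mkcond; apply: eq_esum => x _; rewrite mem_setE.
  by case: ifPn => // /fs ->.
- exact: finite_seq.
- by move=> x _; rewrite lee_fin.
Qed.

(** The opposite inequality is clear from the finite subsums, and this one is
    the opposite inequality for the scalar [k^-1]. *)
Lemma esumZ k (f : T -> \bar R) : 0 <= k -> (forall x, (0 <= f x)%E) ->
  (k%:E * (\esum_(x in [set: T]) f x) <= \esum_(x in [set: T]) (k%:E * f x))%E.
Proof.
have le k' (g : T -> \bar R) : 0 <= k' -> (forall x, (0 <= g x)%E) ->
    (\esum_(x in [set: T]) (k'%:E * g x) <= k'%:E * (\esum_(x in [set: T]) g x))%E.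
  move=> k0 g0; apply: ge_ereal_sup => _ [X [finX _] <-].
  rewrite fsbig_finite //= -ge0_sume_distrr => [|i _]; last exact: g0.
  apply: lee_wpmul2l; first by rewrite lee_fin.
  by apply: ereal_sup_ubound; exists X => //; rewrite fsbig_finite.
rewrite le_eqVlt => /predU1P[<-|k0] f0.
  by rewrite mul0e; apply: esum_ge0 => x _; rewrite mul0e.
have kf0 x : (0 <= k%:E * f x)%E by rewrite mule_ge0 ?lee_fin // ltW.
have kV0 : 0 <= k^-1 by rewrite invr_ge0 ltW.
have := le _ _ kV0 kf0.
under eq_esum => x _.
  rewrite muleA -EFinM mulVf ?gt_eqF // mul1e; over.
have kE0 : (0 <= k%:E)%E by rewrite lee_fin ltW.
move=> /(lee_wpmul2l kE0)/le_trans; apply.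
by rewrite muleA -EFinM mulfV ?gt_eqF // mul1e.
Qed.

Lemma ssum_seq f (s : seq T) : uniq s -> (forall x, x \notin s -> f x = 0) ->
  (ssum f = (\sum_(x <- s) f x)%:E)%E.
Proof.
move=> us fs; rewrite /ssum.
rewrite (@esum_seq (fun x => Num.max (f x) 0) s) //; first last.
- by move=> x /fs ->; rewrite maxxx.
- by move=> x; rewrite le_max lexx orbT.
rewrite (@esum_seq (fun x => Num.max (- f x) 0) s) //; first last.
- by move=> x /fs ->; rewrite oppr0 maxxx.
- by move=> x; rewrite le_max lexx orbT.
rewrite -EFinB -sumrB; congr EFin; apply: eq_bigr => x _.
by rewrite /Order.max; case: ifPn; case: ifPn; lra.
Qed.

Lemma ssum_ge0 f : (forall x, 0 <= f x) ->
  (ssum f = \esum_(x in [set: T]) (f x)%:E)%E.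
Proof.
move=> f0; rewrite /ssum [X in (_ - X)%E]esum1 ?sube0; last first.
  by move=> x _; rewrite max_r // oppr_le0.
by apply: eq_esum => x _; rewrite max_l.
Qed.

Definition jumps r (x : T) : {fset T} := fset_set [set y | y != x /\ r x y != 0].

Definition exit_rate r x : R := \sum_(y <- jumps r x) r x y.

(** The action of the generator on functions, as a finite sum when the row of
    [x] is finite. *)
Definition drift r f x : R := \sum_(y <- jumps r x) r x y * (f y - f x).

Definition row_finite r := forall x, finite_set [set y | y != x /\ r x y != 0].

Lemma driftE r f x :
  drift r f x = \sum_(y <- jumps r x) r x y * f y - exit_rate r x * f x.
Proof.
rewrite /drift /exit_rate mulr_suml -sumrB; apply: eq_bigr => y _.
by rewrite mulrBr.
Qed.

Variable r : T -> T -> R.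
Hypotheses (r_ge0 : forall x y, 0 <= r x y) (r_fin : row_finite r).

Lemma in_jumps x y : (y \in jumps r x) = (y != x) && (r x y != 0).
Proof.
by rewrite in_fset_set //; apply/idP/andP => [|H]; rewrite inE.
Qed.

Lemma exit_rate_ge0 x : 0 <= exit_rate r x.
Proof. by apply: sumr_ge0 => y _; exact: r_ge0. Qed.

Lemma generatorE x y :
  generator r x y = if x == y then - exit_rate r x else r x y.
Proof.
rewrite /generator; case: ifP => // _; rewrite esum_mkcond.
have -> : (\esum_(i in [set: T]) (if i \in [set z | z != x] then (r x i)%:E else 0) =
   (\sum_(y <- jumps r x) if y != x then r x y else 0)%:E)%E.
  rewrite -(@esum_seq (fun y => if y != x then r x y else 0)) ?fset_uniq //.
  - apply: eq_esum => z _; case: (eqVneq z x) => [->|zx].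
      by rewrite memNset //=; apply/negP; rewrite eqxx.
    by rewrite mem_set.
  - by move=> z; case: ifP.
  - move=> z; rewrite in_jumps; by case: ifP => //= _ /negbNE/eqP.
rewrite /= /exit_rate; congr (- _); apply: eq_big_seq => z.
by rewrite in_jumps => /andP[->].
Qed.

Lemma uniq_jumps x : uniq (x :: jumps r x).
Proof. by rewrite /= fset_uniq in_jumps eqxx. Qed.

Lemma ssum_generator x f :
  ssum (fun y => generator r x y * f y) = (drift r f x)%:E.
Proof.
rewrite (@ssum_seq _ (x :: jumps r x)) ?uniq_jumps //.
  rewrite big_cons generatorE eqxx driftE addrC mulNr; congr (_ + _)%:E.
  apply: eq_big_seq => y; rewrite in_jumps generatorE eq_sym.
  by case/andP => /negbTE ->.
move=> y; rewrite inE negb_or in_jumps generatorE eq_sym => /andP[/negbTE yx].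
by rewrite yx /= => /negbNE/eqP ->; rewrite mul0r.
Qed.

End FiniteRows.

Lemma drift_seq (R : realType) (T : choiceType) (r : T -> T -> R) :
  row_finite r -> forall f x (s : seq T), uniq s ->
  (forall y, y != x -> r x y != 0 -> y \in s) ->
  drift r f x = \sum_(y <- s) r x y * (f y - f x).
Proof.
move=> rf f x s us sJ; rewrite /drift.
rewrite (perm_big [seq y <- s | y \in jumps r x]) /=; last first.
  apply: uniq_perm; [exact: fset_uniq|exact: filter_uniq|move=> y].
  rewrite mem_filter in_jumps //; case: andP => [[yx ryx]|_] //=.
  by rewrite sJ.
rewrite big_filter big_mkcond; apply: eq_bigr => y _; rewrite in_jumps //.
case: eqVneq => [->|_] /=; first by rewrite subrr mulr0.
by case: eqVneq => [->|//]; rewrite mul0r.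
Qed.

Lemma generator_dual_drift (R : realType) (T U : choiceType)
    (r : T -> T -> R) (r' : U -> U -> R) (D : T -> U -> R) :
  (forall x y, 0 <= r x y) -> row_finite r ->
  (forall x y, 0 <= r' x y) -> row_finite r' ->
  (forall x y, drift r (D^~ y) x = drift r' (D x) y) ->
  generator_dual (generator r) (generator r') D.
Proof.
move=> r0 rf r'0 r'f rD x y.
rewrite (ssum_generator r0 rf x (D^~ y)) rD -(ssum_generator r'0 r'f).
by congr ssum; apply/funext => z; rewrite mulrC.
Qed.

(** * From generators to semigroups *)

Section LimitsAtZero.
Variable R : realType.

(** The semigroup law transports a property of small times to the time [t] along
    a subdivision of [[0, t]] into equal parts. *)
Lemma near0_subdivision (Q : R -> Prop) (t : R) : 0 < t ->
  (\forall h \near 0^'+, Q h) -> exists n, Q (t / n.+1%:R).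
Proof.
move=> t0 [e /= e0 eQ]; exists (Num.truncn (t / e)).
have n0 : 0 < (Num.truncn (t / e)).+1%:R :> R by rewrite ltr0n.
apply: eQ; last by rewrite divr_gt0.
rewrite /= sub0r normrN gtr0_norm ?divr_gt0 //.
by rewrite ltr_pdivrMr // mulrC -ltr_pdivrMr // truncnS_gt.
Qed.

Lemma mul_le_lim (b r u : R) : 0 <= b ->
  (forall a, a < r -> b * a <= u) -> b * r <= u.
Proof.
move=> b0 H; rewrite leNgt; apply/negP => ur.
have {}b0 : 0 < b.
  rewrite lt_neqAle b0 andbT; apply/eqP => b0E.
  by have := H (r - 1); rewrite -b0E !mul0r in ur *; lra.
have ub : u / b < r by rewrite ltr_pdivrMr // mulrC.
have := H ((u / b + r) / 2) (midf_lt ub).2.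
rewrite leNgt => /negP; apply.
by rewrite mulrC -ltr_pdivrMr // (midf_lt ub).1.
Qed.

Lemma bernoulli_inequality (u : R) n : 0 <= u <= 1 ->
  1 - n%:R * u <= (1 - u) ^+ n.
Proof.
case/andP => u0 u1; elim: n => [|n IH]; first by rewrite mul0r subr0 expr0.
rewrite exprS; apply: (@le_trans _ _ ((1 - u) * (1 - n%:R * u))).
  rewrite -natr1; have := ler0n R n; nra.
by rewrite ler_wpM2l // subr_ge0.
Qed.

(** The right-hand side is the total mass of the approximation of a semigroup
    by [n.+1] Euler steps, in the unit of time where the bound on the exit rates
    is 1. With [u = t / n.+1], it is a power of
    [expR (- u) * (1 + u) >= 1 - u ^+ 2]. *)
Lemma expRN_mul_pow (t : R) n : 0 <= t <= n.+1%:R ->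
  1 - t ^+ 2 / n.+1%:R <= expR (- t) * (1 + t / n.+1%:R) ^+ n.+1.
Proof.
case/andP => t0 tn; set N := n.+1%:R; have N0 : 0 < N by rewrite ltr0n.
set u := t / N; have u0 : 0 <= u by rewrite divr_ge0 // ltW.
have u1 : u <= 1 by rewrite ler_pdivrMr ?mul1r.
have -> : - t = N * (- u) by rewrite /u mulrN mulrC divfK // gt_eqF.
rewrite expRM_natl -exprMn.
have -> : t ^+ 2 / N = N * u ^+ 2.
  by rewrite /u; field; rewrite gt_eqF.
apply: le_trans (bernoulli_inequality n.+1 (u := u ^+ 2) _) _.
  by rewrite sqr_ge0 exprn_ile1.
have := expR_ge1Dx (- u) => eu.
apply: lerXn2r; rewrite ?nnegrE ?mulr_ge0 ?expR_ge0 //; nra.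
Qed.

End LimitsAtZero.

Section BoundedChain.
Variables (R : realType) (T : choiceType) (r : T -> T -> R).
Variable P : R -> T -> T -> R.
Hypotheses (r_ge0 : forall x y, 0 <= r x y) (r_fin : row_finite r).
Hypothesis chainP : is_markov_chain r P.

Lemma semigroup_ge s t x y (l : seq T) : 0 <= s -> 0 <= t -> uniq l ->
  \sum_(z <- l) P s x z * P t z y <= P (s + t) x y.
Proof.
move=> s0 t0 ul; rewrite -lee_fin (transition_semigroup chainP) //.
rewrite -sumEFin fsbig_seq //; apply: esum_ge.
by exists [set` l] => //; split => //; exact: finite_seq.
Qed.

Lemma stay_pow_ge h x n : 0 <= h -> P h x x ^+ n <= P (n%:R * h) x x.
Proof.
move=> h0; elim: n => [|n IH].
  by rewrite mul0r (transition_at0 chainP) eqxx.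
rewrite exprS (_ : n.+1%:R * h = h + n%:R * h); last by rewrite -natr1; ring.
have := @semigroup_ge h (n%:R * h) x x [:: x] h0; rewrite big_seq1.
move=> H; apply: le_trans (H _ _) => //; last by rewrite mulr_ge0.
by rewrite ler_wpM2l // (transition_ge0 chainP).
Qed.

(** The holding time of [x] is exponential. For a parameter [a] larger than the
    exit rate the bound holds at small times by the behaviour at 0, and then at
    all times since the chain may stay at [x] on every interval of a
    subdivision. *)
Lemma stay_ge t x : 0 <= t -> expR (- (exit_rate r x * t)) <= P t x x.
Proof.
rewrite le_eqVlt => /predU1P[<-|t0].
  by rewrite mulr0 oppr0 expR0 (transition_at0 chainP) eqxx.
set e := exit_rate r x; have e0 : 0 <= e by exact: exit_rate_ge0.
have strict a : e < a -> expR (- (a * t)) <= P t x x.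
  move=> ea; have a0 : 0 < a by exact: le_lt_trans ea.
  set b := (e + a) / 2; have eb : e < b by rewrite /b; lra.
  have ba : b < a by rewrite /b; lra.
  have b0 : 0 < b by exact: le_lt_trans eb.
  (* [1 - b h] separates [P h x x] from [expR (- (a h)) <= 1 / (1 + a h)]; the
     second comparison requires [h <= (a - b) / (a b)]. *)
  have [n] : exists n, expR (- (a * (t / n.+1%:R))) <=
      P (t / n.+1%:R) x x.
    apply: (near0_subdivision (Q := fun h => expR (- (a * h)) <= P h x x) t0).
    have := @transition_rates _ _ _ _ chainP x x.
    rewrite generatorE // eqxx -/e => /cvgr_gt /(_ (- b)).
    rewrite ltrN2 => /(_ eb) Hb; near=> h.
    have h0 : 0 < h by near: h; exact: nbhs_right_gt.
    have hsmall : h < (a - b) / (a * b).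
      near: h; apply: nbhs_right_lt.
      by apply: divr_gt0; [rewrite subr_gt0|exact: mulr_gt0].
    have : - b < (P h x x - 1) / h by near: h; exact: Hb.
    rewrite ltr_pdivlMr // => Ph.
    have ah : 0 < 1 + a * h by rewrite addr_gt0 ?mulr_gt0.
    rewrite expRN; apply: (@le_trans _ _ (1 + a * h)^-1).
      by rewrite lef_pV2 ?posrE ?expR_gt0 // expR_ge1Dx.
    apply: (@le_trans _ _ (1 - b * h)); last by lra.
    rewrite -[_^-1]mul1r ler_pdivrMr //.
    rewrite ltr_pdivlMr ?mulr_gt0 // in hsmall; nra.
  set h := t / n.+1%:R => Ph.
  have tE : t = n.+1%:R * h by rewrite /h mulrC divfK // pnatr_eq0.
  have h0 : 0 <= h by rewrite divr_ge0 // ltW.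
  rewrite [X in P X]tE; apply: le_trans (stay_pow_ge x n.+1 h0).
  have -> : - (a * t) = n.+1%:R * (- (a * h)) by rewrite {1}tE; ring.
  by rewrite expRM_natl; apply: lerXn2r; rewrite ?nnegrE ?expR_ge0 //
    (transition_ge0 chainP).
rewrite -[leLHS]mulr1; apply: mul_le_lim; first exact: expR_ge0.
move=> a a1; apply: le_trans (strict (e + (1 - a) / t) _).
  rewrite (_ : - ((e + (1 - a) / t) * t) = - (e * t) + (a - 1)); last first.
    by field; rewrite gt_eqF.
  rewrite expRD ler_wpM2l ?expR_ge0 //.
  by apply: le_trans (expR_ge1Dx _); lra.
by rewrite ltrDl divr_gt0 ?subr_gt0.
Unshelve. all: by end_near.
Qed.

(** The chain may stay at [x], jump to [y] on any one of the [n] intervals, and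
    stay at [y] afterwards. *)
Lemma jump_pow_ge c h x y n : x != y -> 0 <= h ->
  exit_rate r x <= c -> exit_rate r y <= c ->
  n%:R * expR (- (n%:R * (c * h))) * P h x y <= P (n%:R * h) x y.
Proof.
move=> xy h0 xc yc; have c0 : 0 <= c by exact: le_trans (exit_rate_ge0 r_ge0 x) xc.
have Ph0 z w : 0 <= P h z w by exact: (transition_ge0 chainP).
have stay z t : 0 <= t -> exit_rate r z <= c -> expR (- (c * t)) <= P t z z.
  move=> t0 zc; apply: le_trans (stay_ge _ t0).
  by rewrite ler_expR lerN2 ler_wpM2r.
elim: n => [|n IH].
  by rewrite !mul0r (transition_at0 chainP) (negbTE xy).
have nh0 : 0 <= n%:R * h by rewrite mulr_ge0.
have := @semigroup_ge h (n%:R * h) x y [:: x; y] h0 nh0.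
rewrite /= inE xy => /(_ isT); rewrite !big_cons big_nil addr0.
rewrite (_ : h + n%:R * h = n.+1%:R * h); last by rewrite -natr1; ring.
apply: le_trans.
have e1 : expR (- (n.+1%:R * (c * h))) =
   expR (- (c * h)) * expR (- (n%:R * (c * h))).
  by rewrite -expRD; congr expR; rewrite -natr1; ring.
have s1 := stay x h h0 xc; have s2 := stay y _ nh0 yc.
have e2 : expR (- (n%:R * (c * h))) = expR (- (c * (n%:R * h))).
  by congr expR; ring.
have E0 : 0 <= expR (- (n%:R * (c * h))) by exact: expR_ge0.
rewrite e1 -natr1 mulrDl mulrDl lerD //.
  rewrite [n%:R * (_ * _)]mulrCA -mulrA.
  by apply: ler_pM => //; rewrite ?mulr_ge0 ?expR_ge0.
rewrite mul1r mulrC ler_wpM2l // (le_trans _ s2) // -e2.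
by rewrite ger_pMl ?expR_gt0 // -expR0 ler_expR oppr_le0 mulr_ge0.
Qed.

Lemma jump_ge c t x y : x != y -> 0 <= t ->
  exit_rate r x <= c -> exit_rate r y <= c ->
  expR (- (c * t)) * (t * r x y) <= P t x y.
Proof.
move=> xy; rewrite le_eqVlt => /predU1P[<-|t0] xc yc.
  by rewrite mul0r mulr0 (transition_at0 chainP) (negbTE xy).
rewrite mulrA; apply: mul_le_lim; first by rewrite mulr_ge0 ?expR_ge0 // ltW.
move=> a ar.
have [n] : exists n, a * (t / n.+1%:R) <= P (t / n.+1%:R) x y.
  apply: (near0_subdivision (Q := fun h => a * h <= P h x y) t0).
  have := @transition_rates _ _ _ _ chainP x y.
  rewrite generatorE // (negbTE xy) => /cvgr_gt /(_ a ar) Ha; near=> h.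
  have h0 : 0 < h by near: h; exact: nbhs_right_gt.
  rewrite -ler_pdivlMr // ltW //.
  by have : a < (P h x y - 0) / h; [near: h; exact: Ha|rewrite subr0].
set h := t / n.+1%:R => Ph.
have tE : t = n.+1%:R * h by rewrite /h mulrC divfK // pnatr_eq0.
have h0 : 0 <= h by rewrite divr_ge0 // ltW.
have := jump_pow_ge n.+1 xy h0 xc yc; rewrite -tE; apply: le_trans.
rewrite (_ : n.+1%:R * (c * h) = c * t); last by rewrite [in RHS]tE; ring.
rewrite (_ : _ * a = n.+1%:R * expR (- (c * t)) * (a * h)).
  by rewrite ler_wpM2l // mulr_ge0 ?expR_ge0.
by rewrite {2}tE; ring.
Unshelve. all: by end_near.
Qed.


End BoundedChain.

(** The operator 1 + h (L + c), which preserves positivity when [h >= 0] and [c]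
    bounds the exit rates. *)
Definition euler_step (T : choiceType) (R : realType) (r : T -> T -> R) (c h : R)
  (f : T -> R) (x : T) : R := f x + h * (drift r f x + c * f x).

Section EulerStep.
Variables (R : realType) (T : choiceType) (r : T -> T -> R) (c h : R).
Implicit Types f g : T -> R.

Lemma euler_step_cst k x : euler_step r c h (fun=> k) x = (1 + h * c) * k.
Proof.
rewrite /euler_step /drift big1 => [|y _]; last by rewrite subrr mulr0.
by ring.
Qed.

Lemma euler_stepB f g x :
  euler_step r c h (fun z => f z - g z) x =
  euler_step r c h f x - euler_step r c h g x.
Proof.
rewrite /euler_step.
have -> : drift r (fun z => f z - g z) x = drift r f x - drift r g x.
  by rewrite /drift -sumrB; apply: eq_bigr => y _; ring.
by ring.
Qed.

Lemma iter_euler_step_cst n k x :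
  iter n (euler_step r c h) (fun=> k) x = (1 + h * c) ^+ n * k.
Proof.
elim: n x => [|n IH] x; first by rewrite expr0 mul1r.
rewrite iterS (_ : iter n _ _ = fun=> (1 + h * c) ^+ n * k); last exact/funext.
by rewrite euler_step_cst exprS mulrA.
Qed.

Lemma iter_euler_stepB n f g x :
  iter n (euler_step r c h) (fun z => f z - g z) x =
  iter n (euler_step r c h) f x - iter n (euler_step r c h) g x.
Proof.
elim: n x => [//|n IH] x.
rewrite !iterS -euler_stepB; congr (euler_step _ _ _ _ x).
exact/funext.
Qed.

Lemma euler_stepE f x : euler_step r c h f x =
  (1 + h * (c - exit_rate r x)) * f x + \sum_(y <- jumps r x) h * r x y * f y.
Proof.
rewrite /euler_step driftE.
under [in RHS]eq_bigr => y _ do rewrite -mulrA.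
by rewrite -mulr_sumr; ring.
Qed.

End EulerStep.

Lemma euler_step_commute (R : realType) (T U : choiceType)
    (r : T -> T -> R) (r' : U -> U -> R) c h (G : T -> U -> R) x y :
  euler_step r c h (fun x' => euler_step r' c h (G x') y) x =
  euler_step r' c h (fun y' => euler_step r c h (G^~ y') x) y.
Proof.
have key : drift r (fun x' => drift r' (G x') y) x =
           drift r' (fun y' => drift r (G^~ y') x) y.
  rewrite /drift.
  transitivity (\sum_(x' <- jumps r x) \sum_(y' <- jumps r' y)
     r x x' * (r' y y' * (G x' y' - G x' y - (G x y' - G x y)))).
    apply: eq_bigr => x' _; rewrite -sumrB mulr_sumr.
    by apply: eq_bigr => y' _; ring.
  rewrite exchange_big; apply: eq_bigr => y' _.
  by rewrite -sumrB mulr_sumr; apply: eq_bigr => x' _; ring.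
have lin (V : choiceType) (s : V -> V -> R) (f g : V -> R) a b v :
    drift s (fun w => f w + a * (g w + b * f w)) v =
    drift s f v + a * (drift s g v + b * drift s f v).
  rewrite /drift !mulr_sumr -big_split mulr_sumr -big_split /=.
  by apply: eq_bigr => w _; ring.
by rewrite /euler_step !lin key; ring.
Qed.

Section Approximation.
Variables (R : realType) (T : choiceType) (r : T -> T -> R).
Variable P : R -> T -> T -> R.
Hypotheses (r_ge0 : forall x y, 0 <= r x y) (r_fin : row_finite r).
Hypothesis chainP : is_markov_chain r P.
Variables (C : set T) (c : R).
Hypothesis C_closed : forall x y, C x -> y \in jumps r x -> C y.
Hypothesis exit_le : forall x, C x -> exit_rate r x <= c.

(** One step is [stay_ge] and [jump_ge] together with [1 + u <= expR u], and the
    semigroup law iterates it. The iteration stays in [C], where these bounds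
    hold for every [h >= 0] with the same [c]. *)
Lemma expect_ge_euler h n f x : 0 <= h -> (forall y, 0 <= f y) -> C x ->
  ((expR (- (c * h)) ^+ n * iter n (euler_step r c h) f x)%:E <=
   \esum_(y in [set: T]) (P (n%:R * h) x y * f y)%:E)%E.
Proof.
move=> h0 f0; have P0 := transition_ge0 chainP.
elim: n x => [|n IH] x Cx.
  rewrite expr0 mul1r mul0r /=; apply: esum_ge; exists [set x].
    by split => //; exact: finite_set1.
  by rewrite fsbig_set1 (transition_at0 chainP) eqxx mul1r.
have nh0 : 0 <= n%:R * h by rewrite mulr_ge0.
pose S z := (\esum_(y in [set: T]) (P (n%:R * h) z y * f y)%:E)%E.
have S0 z : (0 <= S z)%E by apply: esum_ge0 => y _; rewrite lee_fin mulr_ge0 ?P0.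
apply: (@le_trans _ _ (\sum_(z <- x :: jumps r x) (P h x z)%:E * S z)%E); last first.
  apply: (@le_trans _ _ (\sum_(z <- x :: jumps r x)
      \esum_(y in [set: T]) (P h x z * (P (n%:R * h) z y * f y))%:E)%E).
    apply: lee_sum => z _; under [X in (_ <= X)%E]eq_esum => y _ do rewrite EFinM.
    apply: esumZ; first exact: P0.
    by move=> y; rewrite lee_fin mulr_ge0 ?P0.
  rewrite -esum_sum => [|y z _ _]; last by rewrite lee_fin !mulr_ge0 ?P0.
  apply: le_esum => y _; rewrite sumEFin lee_fin.
  under eq_bigr => z _ do rewrite mulrA.
  rewrite -mulr_suml; apply: ler_wpM2r => //.
  rewrite (_ : n.+1%:R * h = h + n%:R * h); last by rewrite -natr1; ring.
  by apply: (semigroup_ge chainP) => //; exact: uniq_jumps.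
set e := expR _ in IH *; have e0 : 0 <= e by exact: expR_ge0.
pose k z := if z == x then 1 + h * (c - exit_rate r x) else h * r x z.
have exc : 0 <= c - exit_rate r x by rewrite subr_ge0 exit_le.
have k0 z : 0 <= k z.
  by rewrite /k; case: ifP => _; [rewrite addr_ge0 ?mulr_ge0|rewrite mulr_ge0].
have Pk z : z \in x :: jumps r x -> e * k z <= P h x z.
  rewrite inE /k; case: eqP => [-> _|/eqP zx /= zJ].
    apply: le_trans (stay_ge r_ge0 r_fin chainP x h0).
    rewrite (_ : - (exit_rate r x * h) =
      - (c * h) + h * (c - exit_rate r x)); last by ring.
    by rewrite expRD ler_wpM2l // expR_ge1Dx.
  apply: (jump_ge r_ge0 r_fin chainP); rewrite 1?eq_sym //; first exact: exit_le.
  by apply: exit_le; exact: C_closed zJ.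
rewrite iterS euler_stepE exprSr -mulrA.
have -> : e * ((1 + h * (c - exit_rate r x)) * iter n (euler_step r c h) f x +
     \sum_(y <- jumps r x) h * r x y * iter n (euler_step r c h) f y) =
   \sum_(z <- x :: jumps r x) (e * k z) * iter n (euler_step r c h) f z.
  rewrite big_cons {1}/k eqxx mulrDr mulrA; congr (_ + _).
  rewrite mulr_sumr; apply: eq_big_seq => z; rewrite in_jumps // => /andP[zx _].
  by rewrite /k (negbTE zx) !mulrA.
rewrite mulr_sumr -sumEFin big_seq [leRHS]big_seq; apply: lee_sum => z zJ.
have Cz : C z by move: zJ; rewrite inE => /predU1P[->//|]; exact: C_closed.
rewrite mulrCA EFinM; apply: (@le_trans _ _ ((e * k z)%:E * S z)%E).
  by apply: lee_wpmul2l; [rewrite lee_fin mulr_ge0|exact: IH].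
by apply: lee_wpmul2r => //; rewrite lee_fin Pk.
Qed.

(** The lower bound for [B - f] is an upper bound for [f], because [P t x] and
    the Euler approximation have masses 1 and almost 1. *)
Lemma expect_euler_approx t n f B x : 0 <= t -> c * t <= n.+1%:R ->
  (forall y, 0 <= f y <= B) -> C x ->
  exists2 u, (\esum_(y in [set: T]) (P t x y * f y)%:E = u%:E)%E &
  let v := expR (- (c * t)) * iter n.+1 (euler_step r c (t / n.+1%:R)) f x in
  v <= u <= v + B * ((c * t) ^+ 2 / n.+1%:R).
Proof.
move=> t0 ctn fB Cx; set h := t / n.+1%:R; set N := n.+1 in ctn h *.
have N0 : (0 : R) < N%:R by rewrite ltr0n.
have h0 : 0 <= h by rewrite divr_ge0 // ltW.
have tE : N%:R * h = t by rewrite /h mulrC divfK // gt_eqF.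
have P0 := transition_ge0 chainP.
have f0 y : 0 <= f y by have /andP[] := fB y.
have fB' y : 0 <= B - f y by have /andP[_] := fB y; rewrite subr_ge0.
have B0 : 0 <= B by have /andP[] := fB x; exact: le_trans.
have c0 : 0 <= c by exact: le_trans (exit_rate_ge0 r_ge0 x) (exit_le Cx).
have lo := expect_ge_euler N h0 f0 Cx.
have hi := expect_ge_euler N h0 fB' Cx.
have tot : (\esum_(y in [set: T]) (P t x y * f y)%:E +
            \esum_(y in [set: T]) (P t x y * (B - f y))%:E = B%:E)%E.
  rewrite -esumD; try by move=> y _; rewrite lee_fin mulr_ge0 ?P0.
  have leB : (\esum_(y in [set: T]) (B%:E * (P t x y)%:E) <= B%:E)%E.
    apply: ge_ereal_sup => _ [X [finX _] <-].
    rewrite fsbig_finite //= -ge0_sume_distrr => [|y _]; last by rewrite lee_fin P0.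
    rewrite -[leRHS]mule1; apply: lee_wpmul2l; first by rewrite lee_fin.
    rewrite -(transition_sum1 chainP x t0); apply: ereal_sup_ubound.
    by exists X => //; rewrite fsbig_finite.
  rewrite (_ : (fun y => _) = fun y => (B%:E * (P t x y)%:E)%E); last first.
    by apply/funext => y; rewrite -EFinD -EFinM; congr EFin; ring.
  apply/eqP; rewrite eq_le leB /=.
  apply: le_trans (esumZ B0 _) => [|y]; last by rewrite lee_fin P0.
  by rewrite (transition_sum1 chainP) // mule1.
move: lo hi; rewrite !tE -expRM_natl (_ : N%:R * - (c * h) = - (c * t)); last first.
  by rewrite -tE; ring.
rewrite iter_euler_stepB iter_euler_step_cst.
set E1 := (\esum_(y in _) _)%E in tot *; set E2 := (\esum_(y in _) _)%E in tot *.
have : (0 <= E1)%E by apply: esum_ge0 => y _; rewrite lee_fin mulr_ge0 ?P0.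
have : (0 <= E2)%E by apply: esum_ge0 => y _; rewrite lee_fin mulr_ge0 ?P0.
case: E2 tot => [u2| |] //=; case: E1 => [u1| |] //= [uB] _ _.
rewrite !lee_fin => lo hi; exists u1 => //; rewrite lo /=.
have ct0 : 0 <= c * t <= n.+1%:R by rewrite mulr_ge0.
have := expRN_mul_pow ct0.
rewrite -/N (_ : c * t / N%:R = h * c); last by rewrite /h; ring.
move=> /(ler_wpM2l B0) HB.
move: hi HB; set K := (1 + h * c) ^+ N; set k := iter N (euler_step r c h) f x.
by rewrite mulrBr; nra.
Qed.

End Approximation.

(** Both expectations are approximated by Euler schemes with a common [c], and
    the two schemes coincide by [iter_intertwine]. Closed classes of bounded
    rates replace a global bound because the exit rates of an infinite particle
    system grow with the number of particles. *)
Theorem markov_dual_of_drift (R : realType) (T U : choiceType)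
    (r : T -> T -> R) (r' : U -> U -> R) (D : T -> U -> R)
    (P : R -> T -> T -> R) (P' : R -> U -> U -> R) :
  (forall x y, 0 <= r x y) -> row_finite r -> is_markov_chain r P ->
  (forall x y, 0 <= r' x y) -> row_finite r' -> is_markov_chain r' P' ->
  (forall x, exists c (C : set T), [/\ C x,
     forall y z, C y -> z \in jumps r y -> C z &
     forall y, C y -> exit_rate r y <= c]) ->
  (forall x, exists c (C : set U), [/\ C x,
     forall y z, C y -> z \in jumps r' y -> C z &
     forall y, C y -> exit_rate r' y <= c]) ->
  (forall x y, 0 <= D x y) ->
  (forall y, exists B, forall x, D x y <= B) ->
  (forall x, exists B, forall y, D x y <= B) ->
  (forall x y, drift r (D^~ y) x = drift r' (D x) y) ->
  markov_dual P P' D.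
Proof.
move=> r0 rf cP r'0 r'f cP' bd bd' D0 Dbd Dbd' rD t x y t0.
have [c1 [C [Cx Ccl Cc]]] := bd x; have [c2 [C' [Cy C'cl Cc']]] := bd' y.
have [B1 DB1] := Dbd y; have [B2 DB2] := Dbd' x.
pose c := Num.max c1 c2; pose B := Num.max B1 B2.
have {}Cc z : C z -> exit_rate r z <= c.
  by move=> /Cc/le_trans; apply; rewrite le_max lexx.
have {}Cc' z : C' z -> exit_rate r' z <= c.
  by move=> /Cc'/le_trans; apply; rewrite le_max lexx orbT.
have fB z : 0 <= D z y <= B by rewrite D0 (le_trans (DB1 z)) // le_max lexx.
have gB z : 0 <= D x z <= B by rewrite D0 (le_trans (DB2 z)) // le_max lexx orbT.
have P0 z : 0 <= P t x z by exact: (transition_ge0 cP).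
have P'0 z : 0 <= P' t y z by exact: (transition_ge0 cP').
rewrite /expect !ssum_ge0; try by move=> z; rewrite mulr_ge0.
have approx n : c * t <= n.+1%:R -> exists u1 u2,
    [/\ (\esum_(z in [set: T]) (P t x z * D z y)%:E = u1%:E)%E,
        (\esum_(z in [set: U]) (P' t y z * D x z)%:E = u2%:E)%E &
        `|u1 - u2| <= B * ((c * t) ^+ 2 / n.+1%:R)].
  move=> ctn.
  have [u1 E1] := expect_euler_approx r0 rf cP Ccl Cc t0 ctn fB Cx.
  have [u2 E2] := expect_euler_approx r'0 r'f cP' C'cl Cc' t0 ctn gB Cy.
  have -> : iter n.+1 (euler_step r c (t / n.+1%:R)) (D^~ y) x =
            iter n.+1 (euler_step r' c (t / n.+1%:R)) (D x) y.
    apply: (@iter_intertwine R T U setT setT) => //.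
    - move=> f g fg z _; congr (euler_step _ _ _ _ z).
      by apply/funext => w; rewrite fg ?inE.
    - move=> f g fg z _; congr (euler_step _ _ _ _ z).
      by apply/funext => w; rewrite fg ?inE.
    - by move=> G z w; exact: euler_step_commute.
    - by move=> z w _ _; rewrite /euler_step rD.
  cbv zeta; set v := expR _ * _; set w := B * _.
  move=> /andP[l2 h2] /andP[l1 h1]; exists u1, u2; split => //.
  by clearbody v w; rewrite ler_norml; apply/andP; split; lra.
have ct0 : 0 <= c * t.
  by rewrite mulr_ge0 // (le_trans (exit_rate_ge0 r0 x)) // Cc.
have [u1 [u2 [E1 E2 _]]] := approx (Num.truncn (c * t)) (ltW (truncnS_gt _)).
rewrite E1 E2; congr EFin; apply/eqP; rewrite -subr_eq0 -normr_le0 leNgt.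
apply/negP => d0; pose d := `|u1 - u2|.
(* More than [X] steps make the error smaller than the supposed gap [d]; the
   summand [c * t] ensures the hypothesis of [approx]. *)
pose X := c * t + B * (c * t) ^+ 2 / d.
have B0 : 0 <= B by have /andP[] := fB x; exact: le_trans.
have X1 : 0 <= B * (c * t) ^+ 2 / d.
  by apply: divr_ge0; [rewrite mulr_ge0 ?sqr_ge0|exact: ltW].
have Xn : X < (Num.truncn X).+1%:R by exact: truncnS_gt.
set N := (Num.truncn X).+1%:R in Xn; have N0 : 0 < N by rewrite ltr0n.
have [v1 [v2 [F1 F2]]] : exists v1 v2,
    [/\ (\esum_(z in [set: T]) (P t x z * D z y)%:E = v1%:E)%E,
        (\esum_(z in [set: U]) (P' t y z * D x z)%:E = v2%:E)%E &
        `|v1 - v2| <= B * ((c * t) ^+ 2 / N)].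
  by apply: approx; rewrite ltW // (le_lt_trans _ Xn) // lerDl.
move: F1 F2; rewrite E1 E2 => -[<-] [<-].
rewrite mulrA ler_pdivlMr // leNgt => /negP; apply.
rewrite [ltRHS]mulrC -ltr_pdivrMr //.
by rewrite (le_lt_trans _ Xn) // lerDr.
Qed.

(** * Configurations and bond updates *)

Section Configurations.
Variables (R : realType) (m : nat) (q : R) (La : set int).
Hypotheses (q_gt0 : 0 < q) (q_lt1 : q < 1).
Implicit Types eta xi : config m La.
Local Notation p := (q ^+ 2).

Let p_gt0 : 0 < p. Proof. exact: exprn_gt0. Qed.
Let p_lt1 : p < 1. Proof. by rewrite exprn_ilt1 // ltW. Qed.

(** The rates, which involve integer powers of [q], are expressed through natural
    powers of [q ^+ 2]. When more particles stay than there are holes, the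
    exponents may be negative, but then both sides vanish. *)
Lemma pair_rateE k1 k2 l : (k2 <= m)%N ->
  pair_rate m q k1 k2 l = swap_law p m k1 k2 l.
Proof.
move=> k2m; rewrite /pair_rate /swap_law; case: ifP => // lk1.
set t := (k1 - l)%N; set H := (m - k2)%N.
rewrite /rank_law qbinom_sub //.
have q0 : q != 0 by rewrite gt_eqF.
have HE : (m%:Z - k2%:Z) = H%:Z by rewrite -subzn.
have step i : (i <= H)%N ->
    1 - q ^ (2 * (m%:Z - k2%:Z)) * (p^-1) ^+ i = 1 - p ^+ (H - i).
  move=> iH; rewrite HE; congr (1 - _).
  rewrite (_ : 2 * H%:Z = (2 * H)%N :> int) // -exprnP exprM.
  by rewrite exprVn -expfB_cond // gt_eqF.
case: (leqP t H) => tH; last first.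
  rewrite qfall_small // mulr0 mul0r /qpoch (bigD1 (Ordinal tH)) //=.
  by rewrite step // subnn expr0 subrr !(mul0r, mulr0).
congr (_ * _ * _).
  by apply: eq_bigr => i _; rewrite step // ltnW // (leq_trans (ltn_ord i)).
have -> : m%:Z - k2%:Z - k1%:Z + l%:Z = (H - t)%N.
  by rewrite HE -subzn // /t -subzn //; ring.
have -> : 2 * (H - t)%N%:Z * l%:Z = (2 * ((H - t) * l))%N :> int.
  by rewrite -mulrA.
by rewrite -exprnP exprM; congr (_ ^+ (_ * _)%N); rewrite /t; lia.
Qed.

Lemma swap_law_valid k1 k2 l : (k2 <= m)%N -> swap_law p m k1 k2 l != 0 ->
  (l <= k1)%N /\ (k1 + k2 - l <= m)%N.
Proof.
move=> k2m; rewrite /swap_law; case: ifP => [lk|]; last by rewrite eqxx.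
move=> nz; split => //; rewrite leqNgt; apply: contra nz => km.
by rewrite /rank_law qfall_small ?mulr0 ?mul0r //; lia.
Qed.

Lemma occ_le eta x : (occ eta x <= m)%N.
Proof. by rewrite -ltnS; exact: ltn_ord. Qed.

Lemma occ_out eta x : ~ La x -> occ eta x = 0%N.
Proof.
move=> nLa; rewrite /occ; have /asboolP /(_ x nLa) := valP eta.
by move=> ->.
Qed.

Lemma occ_neq0_in eta x : occ eta x != 0%N -> La x.
Proof. by move=> h; apply: contrapT => /(occ_out eta) e; rewrite e in h. Qed.

Lemma config_ext eta xi : occ eta =1 occ xi -> eta = xi.
Proof.
move=> e; apply: val_inj; apply/fsfunP => x; apply: val_inj; exact: e.
Qed.

Definition occupied eta : seq int := finsupp (val eta).

Lemma mem_occupied eta x : (x \in occupied eta) = (occ eta x != 0%N).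
Proof. by rewrite mem_finsupp -val_eqE. Qed.

Lemma uniq_occupied eta : uniq (occupied eta).
Proof. exact: fset_uniq. Qed.

Lemma finite_occ_supp (V : Type) (v : V) eta (A : set int) (F : int -> V) :
  (forall y, occ eta y = 0%N -> F y = v) ->
  finite_set (A `&` F @^-1` [set~ v]).
Proof.
move=> F0; apply: (@sub_finite_set _ _ [set` occupied eta]); last first.
  exact: finite_seq.
move=> y [_ /= Fy]; rewrite mem_occupied; apply/negP => /eqP/F0.
exact: Fy.
Qed.

(** [insubd] returns [eta] itself when one of the two sites is outside of the
    lattice. *)
Definition exchange eta (x : int) (l : nat) : config m La :=
  insubd eta [fsfun val eta with x |-> inord (occ eta x + occ eta (x + 1) - l),
                                 (x + 1) |-> inord l].

Lemma occ_exchange eta x l y : La x -> La (x + 1) ->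
  (l <= m)%N -> (occ eta x + occ eta (x + 1) - l <= m)%N ->
  occ (exchange eta x l) y =
  if y == x then (occ eta x + occ eta (x + 1) - l)%N
  else if y == x + 1 then l else occ eta y.
Proof.
move=> Lx Lx1 lm km; rewrite {1}/occ /exchange insubdK; last first.
  apply/asboolP => z nLz; rewrite !fsfun_withE.
  case: eqP => [zx|_]; first by move: Lx; rewrite -zx => /nLz.
  case: eqP => [zx|_]; first by move: Lx1; rewrite -zx => /nLz.
  by apply: val_inj; exact: (occ_out eta).
rewrite !fsfun_withE; case: ifP => _; first by rewrite /= inordK.
by case: ifP => _ //; rewrite /= inordK.
Qed.

(** An update of positive probability respects the capacity [m] of the left
    site, so that [inord] in [exchange] is applied within its range. *)
Lemma bonds_exchange eta x l : La x -> La (x + 1) ->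
  swap_law p m (occ eta x) (occ eta (x + 1)) l != 0 ->
  bonds eta (exchange eta x l) x /\ occ (exchange eta x l) (x + 1) = l /\
  occ (exchange eta x l) x = (occ eta x + occ eta (x + 1) - l)%N.
Proof.
move=> Lx Lx1 /(swap_law_valid (occ_le _ _)) [lk km].
have lm : (l <= m)%N := leq_trans lk (occ_le _ _).
have x1 : (x + 1 == x) = false by lia.
have ex := occ_exchange _ Lx Lx1 lm km.
have e1 : occ (exchange eta x l) (x + 1) = l by rewrite ex x1 eqxx.
have e0 : occ (exchange eta x l) x = (occ eta x + occ eta (x + 1) - l)%N.
  by rewrite ex eqxx.
split; [split => //|by split].
- by rewrite e0 e1; lia.
- by move=> y yx yx1; rewrite ex (negbTE yx) (negbTE yx1).
Qed.

Lemma bonds_exchange_eq eta xi x : bonds eta xi x ->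
  exchange eta x (occ xi (x + 1)) = xi.
Proof.
move=> [Lx Lx1 s e]; apply: config_ext => y.
have k : (occ eta x + occ eta (x + 1) - occ xi (x + 1))%N = occ xi x by lia.
rewrite occ_exchange ?k ?occ_le //.
by case: eqVneq => [->//|yx]; case: eqVneq => [->//|yx1]; rewrite e.
Qed.

(** A finite set of bonds containing all those that can change [eta]. It is kept
    flexible so that two configurations can share one. *)
Definition bond_cover eta (s : seq int) : Prop :=
  [/\ uniq s, forall x, x \in s -> La x /\ La (x + 1) &
   forall x, La x -> La (x + 1) ->
     (occ eta x + occ eta (x + 1) != 0)%N -> x \in s].

Lemma bonds_in_cover eta xi s x : bond_cover eta s -> xi != eta ->
  bonds eta xi x -> x \in s.
Proof.
case=> _ _ cov ne [Lx Lx1 sm e]; apply: cov => //; apply: contra ne => /eqP s0.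
apply/eqP/config_ext => y.
by case: (eqVneq y x) => [->|yx]; [|case: (eqVneq y (x + 1)) => [->|yx1]];
  [lia|lia|exact: e].
Qed.

(** The bond and the new occupation are recovered from the target [xi], so that
    the double sum has at most one nonzero term. *)
Lemma asep_rateE eta xi s : bond_cover eta s -> xi != eta ->
  asep_rate m q La eta xi = \sum_(x <- s) \sum_(l < m.+1)
    (exchange eta x l == xi)%:R * swap_law p m (occ eta x) (occ eta (x + 1)) l.
Proof.
move=> cov ne; have [us sLa _] := cov; rewrite /asep_rate.
rewrite (@fsbig_seq_supp _ _ _ _ [seq x <- s | x \in bonds eta xi]).
- rewrite big_filter big_mkcond; apply: eq_big_seq => x xs.
  have [Lx Lx1] := sLa x xs; case: ifPn; rewrite ?inE => xb.
    have lm : (occ xi (x + 1) < m.+1)%N by rewrite ltnS occ_le.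
    rewrite (bigD1 (Ordinal lm)) //= (bonds_exchange_eq xb) eqxx mul1r.
    rewrite big1 ?addr0 ?pair_rateE ?occ_le // => l nl.
    case: eqP => [exi|_]; last by rewrite mul0r.
    rewrite mul1r; apply/eqP; apply: contraNT nl => nz.
    have [_ [e _]] := bonds_exchange Lx Lx1 nz.
    by apply/eqP/val_inj; rewrite /= -exi e.
  rewrite big1 // => l _; case: eqP => [exi|_]; last by rewrite mul0r.
  rewrite mul1r; apply/eqP; apply: contraNT xb => nz.
  have [b _] := bonds_exchange Lx Lx1 nz.
  by rewrite -exi mem_set.
- by rewrite filter_uniq.
- by move=> x; rewrite mem_filter => /andP[/set_mem].
- move=> x xb; rewrite mem_filter mem_set // (bonds_in_cover cov ne xb).
  by [].
Qed.

Definition targets eta (s : seq int) : seq (config m La) :=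
  undup [seq exchange eta x (val l) | x <- s, l : 'I_m.+1 <- enum 'I_m.+1].

Lemma asep_rate_targets eta xi s : bond_cover eta s -> xi != eta ->
  asep_rate m q La eta xi != 0 -> xi \in targets eta s.
Proof.
move=> cov ne; apply: contraNT => nt; rewrite (asep_rateE cov ne).
apply/eqP; rewrite big_seq big1 // => x xs; rewrite big1 // => l _.
case: eqP => [exi|_]; last by rewrite mul0r.
case/negP: nt; rewrite mem_undup; apply/allpairsP; exists (x, l).
by rewrite /= mem_enum; split.
Qed.

Lemma asep_rate_ge0 eta xi : 0 <= asep_rate m q La eta xi.
Proof.
apply: sumr_ge0 => x _; rewrite pair_rateE ?occ_le //.
exact: swap_law_ge0.
Qed.

Definition occupied_bonds eta : seq int :=
  undup [seq x <- occupied eta ++ [seq y - 1 | y <- occupied eta] |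
          `[< La x /\ La (x + 1) >]].

Lemma bond_cover_occupied eta : bond_cover eta (occupied_bonds eta).
Proof.
split=> [|x|x Lx Lx1 k]; first exact: undup_uniq.
  by rewrite mem_undup mem_filter => /andP[/asboolP].
rewrite mem_undup mem_filter; apply/andP; split; first exact/asboolP.
rewrite mem_cat mem_occupied; have [k0|//] := eqVneq (occ eta x) 0%N.
rewrite k0 /= in k *; apply/mapP; exists (x + 1); last by rewrite addrK.
by rewrite mem_occupied.
Qed.

Lemma row_finite_asep : row_finite (asep_rate m q La).
Proof.
move=> eta; apply: (@sub_finite_set _ _ [set` targets eta (occupied_bonds eta)]).
  move=> xi [ne nz].
  exact: asep_rate_targets (bond_cover_occupied eta) ne nz.
exact: finite_seq.
Qed.

(** Updates that leave [eta] unchanged appear on the right-hand side only, where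
    their contribution is zero; including them makes the total weight of every
    bond 1. *)
Lemma drift_asep f eta s : bond_cover eta s ->
  drift (asep_rate m q La) f eta = \sum_(x <- s) \sum_(l < m.+1)
    swap_law p m (occ eta x) (occ eta (x + 1)) l *
      (f (exchange eta x l) - f eta).
Proof.
move=> cov.
rewrite (@drift_seq _ _ _ row_finite_asep f eta (targets eta s)) ?undup_uniq //;
  last by move=> xi; exact: asep_rate_targets.
transitivity (\sum_(xi <- targets eta s) \sum_(x <- s) \sum_(l < m.+1)
   (exchange eta x l == xi)%:R *
    (swap_law p m (occ eta x) (occ eta (x + 1)) l * (f xi - f eta))).
  apply: eq_bigr => xi _; have [->|ne] := eqVneq xi eta.
    rewrite subrr mulr0 big1 // => x _; rewrite big1 // => l _.
    by rewrite !mulr0.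
  rewrite (asep_rateE cov ne) mulr_suml; apply: eq_bigr => x _.
  by rewrite mulr_suml; apply: eq_bigr => l _; rewrite mulrA.
rewrite exchange_big; apply: eq_big_seq => x xs; rewrite exchange_big.
apply: eq_bigr => l _; rewrite (bigD1_seq (exchange eta x l)) ?undup_uniq //=.
  rewrite eqxx mul1r big1 ?addr0 // => xi; rewrite eq_sym => /negbTE ->.
  by rewrite mul0r.
rewrite mem_undup; apply/allpairsP; exists (x, l).
by rewrite /= mem_enum; split.
Qed.

Lemma bond_coverU eta xi :
  exists s, bond_cover eta s /\ bond_cover xi s.
Proof.
have [_ sub1 cov1] := bond_cover_occupied eta.
have [_ sub2 cov2] := bond_cover_occupied xi.
exists (undup (occupied_bonds eta ++ occupied_bonds xi)); split; split.
- exact: undup_uniq.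
- by move=> x; rewrite mem_undup mem_cat => /orP[/sub1|/sub2].
- by move=> x Lx Lx1 /(cov1 x Lx Lx1) xs; rewrite mem_undup mem_cat xs.
- exact: undup_uniq.
- by move=> x; rewrite mem_undup mem_cat => /orP[/sub1|/sub2].
- by move=> x Lx Lx1 /(cov2 x Lx Lx1) xs; rewrite mem_undup mem_cat xs orbT.
Qed.

Lemma bonds_refl eta x : La x -> La (x + 1) -> bonds eta eta x.
Proof. by []. Qed.

(** Conservation of the particle number. *)
Lemma sum_occ_bonds (A : set int) eta eta' x : bonds eta eta' x ->
  A x -> A (x + 1) ->
  (\big[addn/0]_(y \in A) occ eta' y = \big[addn/0]_(y \in A) occ eta y)%N.
Proof.
move=> [_ _ s e] Ax Ax1.
have x1 : x + 1 <> x by lia.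
have split2 (zeta : config m La) : (\big[addn/0]_(y \in A) occ zeta y =
    occ zeta x + occ zeta (x + 1) +
    \big[addn/0]_(y \in A `\ x `\ (x + 1)%R) occ zeta y)%N.
  rewrite (fsbigD1_supp _ Ax); last exact: (finite_occ_supp (eta := zeta)).
  rewrite (@fsbigD1_supp _ _ _ _ (x + 1)) /= ?addnA; [by []|by split|].
  exact: (finite_occ_supp (eta := zeta)).
rewrite !split2 s; congr (_ + _)%N; apply: eq_fsbigr => y.
by rewrite inE => -[[_ /eqP yx] /eqP yx1]; exact: e.
Qed.

(** An update of a bond changes only the number of particles to the left of its
    right end. *)
Lemma left_count_bonds eta eta' x y : bonds eta eta' x -> y != x + 1 ->
  left_count eta' y = left_count eta y.
Proof.
move=> b yx1; have [Lx Lx1 _ e] := b.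
have [yx|xy] := leP y x; last first.
  by apply: sum_occ_bonds b _ _; split => //; lia.
apply: eq_fsbigr => z; rewrite inE => -[_ zy]; apply: e; lia.
Qed.

Lemma left_countS eta x : La x ->
  left_count eta (x + 1) = (left_count eta x + occ eta x)%N.
Proof.
move=> Lx; rewrite /left_count (@fsbigD1_supp _ _ _ _ x).
- rewrite addnC; congr (_ + _)%N; apply: eq_fsbigl; apply/seteqP; split => y /=.
    by move=> [[Ly yx1] /eqP yx]; split => //; lia.
  by move=> [Ly yx]; split; [split => //; lia|apply/eqP; lia].
- by split => //; lia.
- exact: (finite_occ_supp (eta := eta)).
Qed.

Definition site_factor (x : int) (N k j : nat) : R :=
  qbinom p k j / qbinom p m j * q ^ (j%:Z * (- (2 * m%:Z * x) + 2 * N%:Z)).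

Lemma duality_funE eta xi : duality_fun m q La eta xi =
  \big[*%R/1]_(x \in La) site_factor x (left_count eta x) (occ eta x) (occ xi x).
Proof. by []. Qed.

Lemma site_factor0 x N k : site_factor x N k 0 = 1.
Proof. by rewrite /site_factor !(qbinom0 p_gt0 p_lt1) divr1 mul0r mulr1. Qed.

Lemma site_factor_ge0 x N k j : 0 <= site_factor x N k j.
Proof.
by rewrite /site_factor !mulr_ge0 ?invr_ge0 ?qbinom_ge0 // exprz_ge0 // ltW.
Qed.

(** The right site sees the [k1] particles of the left one, which accounts for
    the power of [p] in [pair_dual]; the rest depends on [j1 + j2] only. *)
Lemma site_factor_pair x N k1 k2 j1 j2 : (k1 <= m)%N ->
  site_factor x N k1 j1 * site_factor (x + 1) (N + k1) k2 j2 =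
  q ^ ((j1 + j2)%N%:Z * (- (2 * m%:Z * x) + 2 * N%:Z)) * pair_dual p m k1 k2 j1 j2.
Proof.
move=> k1m; have q0 : q != 0 by rewrite gt_eqF.
rewrite /site_factor /pair_dual -exprM exprnN.
set a1 := qbinom _ k1 _ / _; set a2 := qbinom _ k2 _ / _.
rewrite mulrACA [RHS]mulrCA; congr (_ * _).
rewrite -!expfzDr //; congr (q ^ _).
have -> : ((2 * (j2 * (m - k1)))%N : int) = 2 * (j2%:Z * (m%:Z - k1%:Z)).
  by rewrite subzn.
rewrite !PoszD; ring.
Qed.

Lemma duality_fun_bond eta xi x : La x -> La (x + 1) ->
  exists k, forall eta' xi', bonds eta eta' x -> bonds xi xi' x ->
    duality_fun m q La eta' xi' = k * pair_dual p m
      (occ eta' x) (occ eta' (x + 1)) (occ xi' x) (occ xi' (x + 1)).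
Proof.
move=> Lx Lx1.
exists (q ^ ((occ xi x + occ xi (x + 1))%N%:Z *
      (- (2 * m%:Z * x) + 2 * (left_count eta x)%:Z)) *
  \big[*%R/1]_(y \in La `\ x `\ (x + 1))
    site_factor y (left_count eta y) (occ eta y) (occ xi y)).
move=> eta' xi' be bx; have [_ _ _ e] := be; have [_ _ s e'] := bx.
have x1 : x + 1 <> x by lia.
have xx1 : x != x + 1 by lia.
have triv y : occ xi' y = 0%N ->
    site_factor y (left_count eta' y) (occ eta' y) (occ xi' y) = 1.
  by move=> ->; rewrite site_factor0.
rewrite duality_funE (fsbigD1_supp _ Lx); last exact: finite_occ_supp triv.
rewrite (@fsbigD1_supp _ _ _ _ (x + 1)); [|by split|exact: finite_occ_supp triv].
rewrite /= mulrA (left_countS _ Lx) (left_count_bonds be xx1).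
rewrite site_factor_pair ?occ_le // s.
rewrite mulrAC; congr (_ * _ * _); apply: eq_fsbigr => y.
rewrite inE => -[[_ /eqP yx] /eqP yx1].
by rewrite (left_count_bonds be yx1) e // e'.
Qed.

Lemma bond_duality eta xi x : La x -> La (x + 1) ->
  \sum_(l < m.+1) swap_law p m (occ eta x) (occ eta (x + 1)) l *
    (duality_fun m q La (exchange eta x l) xi - duality_fun m q La eta xi) =
  \sum_(l < m.+1) swap_law p m (occ xi x) (occ xi (x + 1)) l *
    (duality_fun m q La eta (exchange xi x l) - duality_fun m q La eta xi).
Proof.
move=> Lx Lx1; have [k Dk] := duality_fun_bond eta xi Lx Lx1.
set D := duality_fun m q La in Dk *.
under eq_bigr => l _ do rewrite mulrBr.
under [RHS]eq_bigr => l _ do rewrite mulrBr.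
rewrite !sumrB -!mulr_suml !swap_law_sum1 ?occ_le // !mul1r; congr (_ - _).
transitivity (k * \sum_(l < m.+1) swap_law p m (occ eta x) (occ eta (x + 1)) l *
  pair_dual p m (occ eta x + occ eta (x + 1) - l) l (occ xi x) (occ xi (x + 1))).
  rewrite mulr_sumr; apply: eq_bigr => l _.
  have [->|nz] := eqVneq (swap_law p m (occ eta x) (occ eta (x + 1)) l) 0.
    by rewrite !mul0r mulr0.
  have [b [e1 e0]] := bonds_exchange Lx Lx1 nz.
  by rewrite (Dk _ _ b (bonds_refl xi Lx Lx1)) e1 e0 mulrCA.
rewrite swap_duality ?occ_le // mulr_sumr; apply: eq_bigr => l _.
have [->|nz] := eqVneq (swap_law p m (occ xi x) (occ xi (x + 1)) l) 0.
  by rewrite !mul0r mulr0.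
have [b [e1 e0]] := bonds_exchange Lx Lx1 nz.
by rewrite (Dk _ _ (bonds_refl eta Lx Lx1) b) e1 e0 mulrCA.
Qed.

Lemma drift_duality eta xi :
  drift (asep_rate m q La) ((duality_fun m q La)^~ xi) eta =
  drift (asep_rate m q La) (duality_fun m q La eta) xi.
Proof.
have [s [c1 c2]] := bond_coverU eta xi.
rewrite (drift_asep _ c1) (drift_asep _ c2); apply: eq_big_seq => x xs.
have [_ sLa _] := c1; have [Lx Lx1] := sLa x xs.
exact: bond_duality.
Qed.

Definition particles eta : nat := (\big[addn/0]_(y \in [set: int]) occ eta y)%N.

Lemma particles_jump eta xi : xi \in jumps (asep_rate m q La) eta ->
  particles xi = particles eta.
Proof.
rewrite in_jumps; last exact: row_finite_asep.
case/andP => ne nz; have [x b] : exists x, bonds eta xi x.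
  apply: contrapT => nb; move/eqP: nz; apply; apply: fsbig1 => x b.
  by case: nb; exists x.
exact: (sum_occ_bonds (A := setT) b).
Qed.

Lemma size_occupied_bonds eta :
  (size (occupied_bonds eta) <= 2 * particles eta)%N.
Proof.
have szo : (size (occupied eta) <= particles eta)%N.
  rewrite /particles (@fsbig_seq_supp _ _ _ _ (occupied eta)) //.
  - rewrite -sum1_size big_seq [leqRHS]big_seq; apply: leq_sum => y.
    by rewrite mem_occupied lt0n.
  - exact: uniq_occupied.
  - by move=> y _; rewrite mem_occupied => /negbNE/eqP.
rewrite (leq_trans (size_undup _)) // size_filter.
by rewrite (leq_trans (count_size _ _)) // size_cat size_map mul2n -addnn leq_add.
Qed.

(** Every bond is updated at total rate 1, and only the bonds next to a particle
    matter. *)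
Lemma exit_rate_asep_le eta :
  exit_rate (asep_rate m q La) eta <= (2 * particles eta)%:R.
Proof.
(* The exit rate is the drift of the indicator of having left [eta]. *)
have -> : exit_rate (asep_rate m q La) eta =
    drift (asep_rate m q La) (fun xi => (xi != eta)%:R) eta.
  rewrite /drift eqxx; apply: eq_big_seq => xi.
  rewrite in_jumps; last exact: row_finite_asep.
  by case/andP => -> _; rewrite subr0 mulr1.
rewrite (drift_asep _ (bond_cover_occupied eta)) eqxx.
apply: (@le_trans _ _ (\sum_(x <- occupied_bonds eta) 1)).
  apply: ler_sum => x _.
  rewrite -[leRHS](swap_law_sum1 p_gt0 p_lt1 (occ_le eta x) (occ_le eta (x + 1))).
  apply: ler_sum => l _; rewrite subr0 ler_piMr ?swap_law_ge0 //.
  by rewrite lern1 leq_b1.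
by rewrite big_const_seq count_predT iter_addr_0 ler_nat size_occupied_bonds.
Qed.

Lemma asep_bounded_class eta : exists c (C : set (config m La)), [/\ C eta,
  forall zeta xi, C zeta -> xi \in jumps (asep_rate m q La) zeta -> C xi &
  forall zeta, C zeta -> exit_rate (asep_rate m q La) zeta <= c].
Proof.
exists (2 * particles eta)%:R, [set zeta | particles zeta = particles eta].
split => //= zeta; first by move=> xi <- /particles_jump.
by move=> <-; exact: exit_rate_asep_le.
Qed.

Lemma duality_fun_ge0 eta xi : 0 <= duality_fun m q La eta xi.
Proof. by apply: prodr_ge0 => x _; exact: site_factor_ge0. Qed.

Lemma duality_fun_seq eta xi (s : seq int) : uniq s ->
  (forall x, x \in s -> La x) -> (forall x, occ xi x != 0%N -> x \in s) ->
  duality_fun m q La eta xi =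
  \prod_(x <- s) site_factor x (left_count eta x) (occ eta x) (occ xi x).
Proof.
move=> us sLa sxi; rewrite duality_funE (fsbig_seq_supp _ us sLa) // => x _ xs.
have /eqP -> : occ xi x == 0%N by apply: contraNT xs; exact: sxi.
exact: site_factor0.
Qed.

Lemma occupied_in eta x : x \in occupied eta -> La x.
Proof. by rewrite mem_occupied; exact: occ_neq0_in. Qed.

(** The particles to the left of [x] enter with a nonnegative power of [q], hence
    can be removed from an upper bound. *)
Lemma duality_fun_bounded_left xi :
  exists B, forall eta, duality_fun m q La eta xi <= B.
Proof.
(* A sum over all occupations dominates each of its terms. *)
exists (\prod_(x <- occupied xi) \sum_(k < m.+1) site_factor x 0 k (occ xi x)).
move=> eta; rewrite (duality_fun_seq eta (uniq_occupied xi)); first last.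
- by move=> x; rewrite mem_occupied.
- exact: occupied_in.
apply: ler_prod => x _; rewrite site_factor_ge0 /=.
have k : (occ eta x < m.+1)%N by rewrite ltnS occ_le.
rewrite (bigD1 (Ordinal k)) //=; apply: ler_wpDr.
  by apply: sumr_ge0 => i _; exact: site_factor_ge0.
rewrite /site_factor ler_wpM2l ?mulr_ge0 ?invr_ge0 ?qbinom_ge0 //.
rewrite mulr0 addr0 mulrDr expfzDr ?gt_eqF //.
rewrite ler_piMr ?exprz_ge0 ?(ltW q_gt0) //.
rewrite (_ : _ * (2 * _) = (occ xi x * (2 * left_count eta x))%N :> int) //.
by rewrite -exprnP exprn_ile1 // ltW.
Qed.

(** [duality_fun eta xi] vanishes unless [xi] lives on the occupied sites of
    [eta]. *)
Lemma duality_fun_bounded_right eta :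
  exists B, forall xi, duality_fun m q La eta xi <= B.
Proof.
exists (\prod_(x <- occupied eta) \sum_(j < m.+1)
  site_factor x (left_count eta x) (occ eta x) j) => xi.
have F0 x N k (j : nat) := site_factor_ge0 x N k j.
have [sub|[x [xx ex]]] : (forall x, occ xi x != 0%N -> x \in occupied eta) \/
    (exists x, occ xi x != 0%N /\ occ eta x = 0%N).
  have [?|nx] := pselect (exists x, occ xi x != 0%N /\ occ eta x = 0%N).
    by right.
  left => x xx; rewrite mem_occupied; apply/eqP => ex; apply: nx; by exists x.
- rewrite (duality_fun_seq eta (uniq_occupied eta)) //; last exact: occupied_in.
  apply: ler_prod => x _; rewrite F0 /=.
  have k : (occ xi x < m.+1)%N by rewrite ltnS occ_le.
  rewrite (bigD1 (Ordinal k)) //=; apply: ler_wpDr => //.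
  by apply: sumr_ge0 => i _.
- rewrite (duality_fun_seq eta (uniq_occupied xi)); first last.
  + by move=> y; rewrite mem_occupied.
  + exact: occupied_in.
  rewrite (bigD1_seq x) ?uniq_occupied ?mem_occupied //=.
  rewrite {1}/site_factor ex qbinom_small ?lt0n // !mul0r.
  by apply: prodr_ge0 => y _; apply: sumr_ge0.
Qed.

End Configurations.

Theorem theorem1p4 (R : realType) (m : nat) (q : R) (La : set int)
  (m_ge1 : (1 <= m)%N) (q_gt0 : 0 < q) (q_lt1 : q < 1)
  (La_consecutive : forall x y z : int, La x -> La z -> x <= y <= z -> La y) :
  generator_dual (generator (asep_rate m q La)) (generator (asep_rate m q La))
    (duality_fun m q La) /\
  (forall P : R -> config m La -> config m La -> R,
     is_markov_chain (asep_rate m q La) P ->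
     markov_dual P P (duality_fun m q La)).
Proof.
have r0 := asep_rate_ge0 (La := La) (m := m) q_gt0 q_lt1.
have rf := row_finite_asep (La := La) (m := m) q_gt0 q_lt1.
have dd := drift_duality (La := La) (m := m) q_gt0 q_lt1.
split=> [|P chainP]; first exact: generator_dual_drift.
have cls := asep_bounded_class (La := La) (m := m) q_gt0 q_lt1.
apply: (markov_dual_of_drift r0 rf chainP r0 rf chainP cls cls) => //.
- exact: duality_fun_ge0.
- exact: duality_fun_bounded_left.
- exact: duality_fun_bounded_right.
Qed.
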